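(* For the hidden Markov random field described in the context, suppose that the specification $\gamma$ is monotone. Then $|\mathscr{G}(\gamma)|=1$ implies that $|\mathscr{G}(\gamma^Y)|=1$ a.s. In particular, if $\gamma$ is monotone, uniqueness of the underlying random field (that is, $|\mathscr{G}(\gamma)|=1$) implies that $(X_v,Y_v)_{v\in\mathbb{Z}^d}$ is conditionally mixing.
   Context: Notation. $E=F=\{-1,1\}$. For $V\subseteq\mathbb{Z}^d$: $V^c=\mathbb{Z}^d\setminus V$; $\partial V=\{w\in V^c:\|v-w\|=1\text{ for some }v\in V\}$ (nearest neighbours); $X_V=(X_v)_{v\in V}$; $V\subset\subset\mathbb{Z}^d$ means $V$ is a finite subset. For a transition kernel $\kappa$ and function $f$, $(\kappa f)(x)=\int f(z)\,\kappa(x,dz)$. Specification. A family $\gamma=(\gamma_V)_{V\subset\subset\mathbb{Z}^d}$ of transition (probability) kernels on $E^{\mathbb{Z}^d}$ is a specification if (1) $\gamma_V(x,A)$ is a function of $x_{\partial V}$ for every $A\in\sigma\{X_V\}$; (2) $\gamma_V(x,A)=\mathbf{1}_A(x)$ for every $A\in\sigma\{X_{V^c}\}$; (3) $\gamma_V\gamma_W=\gamma_V$ for every $W\subset V\subset\subset\mathbb{Z}^d$. A random field $X=(X_v)_{v\in\mathbb{Z}^d}$ is specified by $\gamma$ if $\mathbf{P}[X\in A|X_{V^c}]=\gamma_V(X,A)$ a.s. for every measurable $A$ and $V\subset\subset\mathbb{Z}^d$. $\mathscr{G}(\gamma)$ is the set of all laws of random fields specified by $\gamma$. Monotone. A function $f:\{-1,1\}^{\mathbb{Z}^d}\to\mathbb{R}$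 is increasing if $f(x)\ge f(z)$ whenever $x_v\ge z_v$ for all $v$. $\gamma$ is monotone if $\gamma_Vf$ is increasing for every bounded increasing (measurable) $f$ and every $V\subset\subset\mathbb{Z}^d$. Model. $X=(X_v)_{v\in\mathbb{Z}^d}$ is a $\{-1,1\}$-valued random field specified by a given specification $\gamma$; $Y_v=X_v\xi_v$, where $(\xi_v)_{v\in\mathbb{Z}^d}$ are independent $\{-1,1\}$-valued random variables, independent of $X$, with $\mathbf{P}[\xi_v=-1]=p_v$ and $0<p_v\le 1/2$ for all $v$. Put $g_v(x_v,y_v)=\mathbf{P}[Y_v=y_v|X_v=x_v]$, i.e. $1-p_v$ if $x_v=y_v$ and $p_v$ otherwise. Conditional specification. For $y\in\{-1,1\}^{\mathbb{Z}^d}$, $\gamma^y=(\gamma^y_V)_{V\subset\subset\mathbb{Z}^d}$ is the specification $$\gamma_V^y(x,A)=\frac{\int\mathbf{1}_A(z)\prod_{v\in V}g_v(z_v,y_v)\,\gamma_V(x,dz)}{\int\prod_{v\in V}g_v(z_v,y_v)\,\gamma_V(x,dz)}.$$ Conditionally mixing means: $\lim_{W\subset\subset\mathbb{Z}^d}\mathbf{E}|\mathbf{P}[X_V\in A|X_{W^c},Y]-\mathbf{P}[X_V\in A|Y]|=0$ for every set $A$ and $V\subset\subset\mathbb{Z}^d$, where the limit is along the net of finite subsets $W$ directed by inclusion. *)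

(* Defs.v *)
From HB Require Import structures.
From mathcomp Require Import all_boot all_order all_algebra finmap.
From mathcomp Require Import all_classical all_reals all_analysis giry measurable_realfun.

Set Implicit Arguments.
Unset Strict Implicit.
Unset Printing Implicit Defensive.
Import Order.TTheory GRing.Theory Num.Theory.
Import numFieldNormedType.Exports.

Local Open Scope classical_set_scope.
Local Open Scope ring_scope.

(* The spin set {-1, 1} is encoded by bool, with true for 1 and false for -1;
   products and comparisons of spins are those of their values in int. *)
Notation spin := bool.
Definition spin_val (s : spin) : int := if s then 1 else -1.
Definition spin_mul (s t : spin) : spin := s == t.

Lemma spin_valM (s t : spin) :
  spin_val (spin_mul s t) = spin_val s * spin_val t.
Proof. by case: s; case: t. Qed.

Notation site d := 'rV[int]_d.

(* l^1 distance 1; the norm of the library on 'rV is the sup norm, for which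
   diagonal steps would also have length 1. *)
Definition neighbour (d : nat) (v w : site d) : Prop :=
  \sum_(i < d) `|v 0 i - w 0 i| = 1.

Definition boundary (d : nat) (V : {fset site d}) : set (site d) :=
  [set w | w \notin V /\ exists2 v, v \in V & neighbour v w].

Definition complement (d : nat) (V : {fset site d}) : set (site d) :=
  [set v | v \notin V].

(* sigma{Z_v : v in V} for a family of spin-valued maps Z on an arbitrary set *)
Definition sigma_field (d : nat) (Omega : Type) (Z : Omega -> site d -> spin)
    (V : set (site d)) : set (set Omega) :=
  <<s \bigcup_(v in V)
        preimage_set_system [set: Omega] (fun w => Z w v) measurable >>.

Definition coordinate_events (d : nat) : set (set (site d -> spin)) :=
  \bigcup_(v in [set: site d])
    preimage_set_system [set: site d -> spin]
      (fun x : site d -> spin => x v) measurable.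
Arguments coordinate_events : clear implicits.

(* {-1, 1}^(Z^d) with its product sigma-algebra *)
Notation config d := (g_sigma_algebraType (coordinate_events d)).

Definition restriction (d : nat) (V : {fset site d}) (x : config d) : {ffun V -> spin} :=
  [ffun v => x (val v)].

(* the filter of the net of finite subsets directed by inclusion *)
Definition fset_net (T : choiceType) : set_system {fset T} :=
  filter_from setT (fun W0 => [set W | (W0 `<=` W)%fset]).
Arguments fset_net : clear implicits.

Global Instance fset_net_filter (T : choiceType) : ProperFilter (fset_net T).
Proof.
apply: filter_from_proper => [|W0 _]; last by exists W0 => /=.
apply: filter_from_filter; first by exists fset0.
move=> U V _ _; exists (U `|` V)%fset => //= W UVW.
by split; apply: fsubset_trans UVW; [exact: fsubsetUl|exact: fsubsetUr].
Qed.

Section conditional_probability.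
Context {dO : measure_display} {Omega : measurableType dO} {R : realType}.
Variable P : probability Omega R.

Definition is_cond_prob (G : set (set Omega)) (B : set Omega)
    (f : Omega -> R) : Prop :=
  [/\ forall D : set R, measurable D -> G (f @^-1` D),
      P.-integrable [set: Omega] (EFin \o f)
    & forall C, G C -> (\int[P]_(w in C) (f w)%:E = P (B `&` C))%E].

(* For a sub-sigma-algebra G, a version of P[B | G]; any two agree a.s. *)
Definition cond_prob (G : set (set Omega)) (B : set Omega) : Omega -> R :=
  get (is_cond_prob G B).

Lemma is_cond_prob_cond_prob (G : set (set Omega)) (B : set Omega) :
  sigma_algebra setT G -> G `<=` measurable -> measurable B ->
  is_cond_prob G B (cond_prob G B).
Proof.
move=> sG Gm mB; rewrite /cond_prob.
suff [f fP] : exists f, is_cond_prob G B f by exact: (@getI _ _ f).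
have GE : <<s G >> = G by exact: sigma_algebra_id.
pose T := g_sigma_algebraType G.
have mid : measurable_fun [set: Omega] (idfun : Omega -> T).
  by move=> _ Y /= mY; rewrite setTI; apply: Gm; rewrite -GE.
pose phi : {mfun Omega >-> T} := HB.pack (idfun : Omega -> T)
  (isMeasurableFun.Build _ _ _ _ _ mid).
pose mu := distribution P phi.
have [nu nuE] : exists nu : {finite_measure set T -> \bar R},
    forall C, nu C = P (C `&` B).
  pose nu0 : {measure set T -> \bar R} :=
    measure_function_pushforward__canonical__measure_function_Measure
      (mrestr P mB) mid.
  have nu0T : (nu0 setT < +oo)%E.
    rewrite /= /pushforward /mrestr preimage_setT setTI.
    by rewrite -ge0_fin_numE// fin_num_measure.
  exists (mfrestr measurableT nu0T) => C.
  by transitivity (nu0 (C `&` setT)) => //; rewrite setIT.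
have numu : nu `<< mu.
  apply/null_content_dominatesP => C mC muC0; rewrite nuE.
  have mC' : measurable (C : set Omega) by apply: Gm; rewrite -GE.
  apply/eqP; rewrite -measure_le0 -muC0.
  exact: measureIl.
pose f := Radon_Nikodym_SigmaFinite.f nu mu.
have f0 := Radon_Nikodym_SigmaFinite.f_ge0 numu.
have fE x : (fine (f x))%:E = f x.
  by rewrite fineK// (Radon_Nikodym_SigmaFinite.f_fin_num numu).
have /integrableP[mf foo] := Radon_Nikodym_SigmaFinite.f_integrable numu.
have fEE : (EFin \o (fun w => fine (f w))) = f \o phi.
  by apply/funext => w; exact: fE.
exists (fun w => fine (f w)); split.
- move=> D mD; rewrite -GE.
  have : measurable_fun [set: T] (fine \o f).
    apply/measurable_EFinP.
    have -> : EFin \o (fine \o f) = f by apply/funext => w; exact: fE.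
    exact: mf.
  by move=> /(_ measurableT D mD); rewrite setTI.
- rewrite fEE; apply/integrableP; split.
    exact: (measurableT_comp mf mid).
  move: foo; rewrite ge0_integral_pushforward//.
  exact/measurableT_comp.
- move=> C GC.
  have mC : measurable (C : set T) by rewrite /measurable /= GE.
  under eq_integral do rewrite fE.
  rewrite setIC -nuE (Radon_Nikodym_SigmaFinite.f_integral numu mC).
  by rewrite ge0_integral_pushforward//; exact: measurable_funTS.
Qed.

End conditional_probability.

Section fields.
Context {R : realType} {d : nat}.

Definition kernel_family : Type :=
  {fset site d} -> config d -> set (config d) -> \bar R.

Definition is_specification
    (gamma : {fset site d} -> R.-pker (config d) ~> (config d)) : Prop :=
  [/\ forall V (A : set (config d)), sigma_field id [set` V] A ->
        forall x x' : config d, (forall v, boundary V v -> x v = x' v) ->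
        gamma V x A = gamma V x' A,
      forall V (A : set (config d)), sigma_field id (complement V) A ->
        forall x, gamma V x A = (\1_A x)%:E
    & forall V W, (W `<=` V)%fset -> forall x (A : set (config d)),
        measurable A -> kcomp_noparam (gamma V) (gamma W) x A = gamma V x A].

Definition specified_by {dO : measure_display} {Omega : measurableType dO}
    (P : probability Omega R) (X : {mfun Omega >-> config d})
    (kappa : kernel_family) : Prop :=
  forall (V : {fset site d}) (A : set (config d)), measurable A ->
  {ae P, forall w,
    (cond_prob P (sigma_field X (complement V)) (X @^-1` A) w)%:E
    = kappa V (X w) A}.

Definition gibbs (kappa : kernel_family) : set (probability (config d) R) :=
  [set mu | exists (dO : measure_display) (Omega : measurableType dO)
              (P : probability Omega R) (X : {mfun Omega >-> config d}),
    specified_by P X kappa /\ mu ≡μ distribution P X].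

(* |G(kappa)| = 1; measures are total functions on sets in the library, hence
   laws are identified when they agree on measurable sets. *)
Definition gibbs_unique (kappa : kernel_family) : Prop :=
  exists2 mu, gibbs kappa mu & forall nu, gibbs kappa nu -> nu ≡μ mu.

Definition config_le (x z : config d) : Prop :=
  forall v, spin_val (x v) <= spin_val (z v).

Definition spin_increasing (f : config d -> R) : Prop :=
  forall x z, config_le z x -> f z <= f x.

Definition monotone_specification
    (gamma : {fset site d} -> R.-pker (config d) ~> (config d)) : Prop :=
  forall f : config d -> R, measurable_fun [set: config d] f ->
  (exists M : R, forall x, `|f x| <= M) -> spin_increasing f ->
  forall V, spin_increasing (fun x => \int[gamma V x]_z f z).

Definition obs_density (p : site d -> R) (v : site d) (s t : spin) : R :=
  if s == t then 1 - p v else p v.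

Definition cond_specification
    (gamma : {fset site d} -> R.-pker (config d) ~> (config d))
    (p : site d -> R) (y : config d) : kernel_family :=
  fun V x A =>
  ((\int[gamma V x]_z (\1_A z * \prod_(v <- V) obs_density p v (z v) (y v)))
   / (\int[gamma V x]_z \prod_(v <- V) obs_density p v (z v) (y v)))%:E.

Section hidden.
Context {dO : measure_display} {Omega : measurableType dO}.
Variable P : probability Omega R.

Definition independent_sites (Z : {mfun Omega >-> config d}) : Prop :=
  forall (V : {fset site d}) (B : site d -> set spin),
  P [set w | forall v, v \in V -> B v (Z w v)]
  = (\prod_(v <- V) P [set w | B v (Z w v)])%E.

Definition independent_fields (X Z : {mfun Omega >-> config d}) : Prop :=
  forall A B : set (config d), measurable A -> measurable B ->
  P (X @^-1` A `&` Z @^-1` B) = (P (X @^-1` A) * P (Z @^-1` B))%E.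

Definition observed (X xi : {mfun Omega >-> config d}) (w : Omega) : config d :=
  fun v => spin_mul (X w v) (xi w v).

Definition conditionally_mixing (X : {mfun Omega >-> config d})
    (Y : Omega -> config d) : Prop :=
  forall (V : {fset site d}) (A : set {ffun V -> spin}),
  let E := [set w | A (restriction V (X w))] in
  (fun W : {fset site d} =>
    'E_P[(fun w =>
      `|cond_prob P <<s sigma_field X (complement W) `|` sigma_field Y setT >> E w
        - cond_prob P (sigma_field Y setT) E w|)%R])%E @ fset_net (site d) --> 0%E.

End hidden.
End fields.
Arguments kernel_family : clear implicits.

(* Main.v *)
From HB Require Import structures.
Require Import Defs.
From mathcomp Require Import all_boot all_order all_algebra finmap.
From mathcomp Require Import all_classical all_reals all_analysis measurable_realfun giry.
From mathcomp Require Import ring lra zify.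

Set Implicit Arguments.
Unset Strict Implicit.
Unset Printing Implicit Defensive.
Import Order.TTheory GRing.Theory Num.Theory.
Import numFieldNormedType.Exports.

Local Open Scope classical_set_scope.
Local Open Scope ring_scope.

(** Write L V f x for the integral of f under gamma_V(x, .). Conditioning on the
observations multiplies gamma_V by a product weight. If gamma is monotone,
multiplying the weight at one site and raising its ratio at +1 to -1 preserves
monotonicity and increases the integrals of increasing functions: condition on
the spin at that site, using L V = L V (L (V \ u)). Site by site, for f increasing,
gamma^y_V f is increasing both in the boundary condition and in y.

Observations drawn under the + boundary condition dominate Y, and averaging
gamma^y_W f over observations drawn from gamma_W itself gives back gamma_W f.
Hence E gamma^Y_W f(+) <= gamma_W f(+) and E gamma^Y_W f(-) >= gamma_W f(-): the
expected gap between the extreme boundary conditions of gamma^Y is at most the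
gap of gamma. The latter vanishes as W grows when gamma has a unique Gibbs
measure, since the limits of gamma_W(+, .) and gamma_W(-, .) exist by monotonicity
and are Gibbs. The gaps of gamma^Y decrease in W, so they vanish almost surely.

The gaps of single spins control all local functions: if f depends on V and
0 <= f <= 1, then both (number of + spins in V) + f and (number of + spins in V) - f
are increasing. This gives uniqueness for gamma^Y, and also mixing, because the
conditional probability given X off W and Y is gamma^Y_W(X, .), which is within
the gap of the Y-measurable gamma^Y_W(+, .). *)

(** * Monotonicity in finite volume *)

(** Both gamma and gamma^y are treated as abstract operators [L]: the axioms [spec_op] are stable
    under [tilt], so each consequence of monotonicity is proved once and used for both. The
    operators act on arbitrary functions, which makes sense because a boundary condition leaves only
    finitely many configurations in a finite volume; measurability enters only with random fields
    and Gibbs measures. The weights of gamma^y act on all sites of V at once, whereas the comparison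
    behind monotonicity is an elementary inequality for two-point laws. This is why a tilt is
    decomposed into single-site tilts, each applied to an operator already known to be monotone. The
    dependence of gamma_V on a finite neighbourhood keeps [L V f] a cylinder function when [f] is
    one, so the DLR equations survive limits of expectations of cylinder functions. The exceptional
    null set must serve all volumes and all functions at once. Control by the gaps of single sites
    along one countable exhaustion reduces this to countably many events. *)

Section finite_volume.
Context {R : realType} {S : choiceType}.
Implicit Types (U V W : {fset S}) (x z : S -> bool) (f k : (S -> bool) -> R).

Definition depends_on (D : set S) f :=
  forall x z, (forall v, D v -> x v = z v) -> f x = f z.

Definition spin_le x z := forall v, x v ==> z v.

Definition increasing f := forall x z, spin_le x z -> f x <= f z.

Definition glue V x (s : {ffun V -> bool}) : S -> bool :=
  fun v => if insub v is Some v' then s v' else x v.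

Definition spins_on V x : {ffun V -> bool} := [ffun v => x (val v)].

Definition pattern V (s : {ffun V -> bool}) : (S -> bool) -> R :=
  fun z => (spins_on V z == s)%:R.

(* [L V f x] stands for the integral of [f] under gamma_V(x, .): [opM] says that
   gamma_V does not change the spins off V, [op_depends] that it only looks at the
   spins on the finite set [N V], and [opK] is gamma_V gamma_W = gamma_V. *)
Record spec_op (L : {fset S} -> ((S -> bool) -> R) -> (S -> bool) -> R)
    (N : {fset S} -> {fset S}) : Prop := SpecOp {
  opD : forall V f k x, L V (fun z => f z + k z) x = L V f x + L V k x;
  op_ge0 : forall V f x, (forall z, 0 <= f z) -> 0 <= L V f x;
  op1 : forall V x, L V (fun=> 1) x = 1;
  opM : forall V f k x, depends_on (~` [set` V]) k ->
    L V (fun z => k z * f z) x = k x * L V f x;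
  op_depends : forall V D f, depends_on D f ->
    depends_on ((D `|` [set` N V]) `\` [set` V]) (L V f);
  opK : forall V W f x, (W `<=` V)%fset -> L V (L W f) x = L V f x }.

Lemma glue_in V x (s : {ffun V -> bool}) (v : V) : glue x s (val v) = s v.
Proof. by rewrite /glue valK. Qed.

Lemma glue_out V x (s : {ffun V -> bool}) v : v \notin V -> glue x s v = x v.
Proof. by move=> vV; rewrite /glue insubN. Qed.

Lemma spins_onK V x z : (forall v, v \notin V -> z v = x v) ->
  glue x (spins_on V z) = z.
Proof.
move=> xz; apply/funext => v; rewrite /glue; case: insubP => [u _ <-|vV].
  by rewrite ffunE.
by rewrite xz.
Qed.

Lemma spins_on_glue V x (s : {ffun V -> bool}) : spins_on V (glue x s) = s.
Proof. by apply/ffunP => v; rewrite ffunE glue_in. Qed.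

Lemma depends_onW (D D' : set S) f : D `<=` D' -> depends_on D f -> depends_on D' f.
Proof. by move=> DD' fD x z xz; apply: fD => v /DD'; exact: xz. Qed.

Lemma depends_onT f : depends_on setT f.
Proof. by move=> x z xz; congr f; apply/funext => v; exact: xz. Qed.

Lemma depends_onM D f k : depends_on D f -> depends_on D k ->
  depends_on D (fun z => f z * k z).
Proof. by move=> fD kD x z xz; rewrite (fD _ _ xz) (kD _ _ xz). Qed.

Lemma depends_onD D f k : depends_on D f -> depends_on D k ->
  depends_on D (fun z => f z + k z).
Proof. by move=> fD kD x z xz; rewrite (fD _ _ xz) (kD _ _ xz). Qed.

Lemma depends_onN D f : depends_on D f -> depends_on D (fun z => - f z).
Proof. by move=> fD x z xz; rewrite (fD _ _ xz). Qed.

Lemma depends_on_sum (I : Type) (r : seq I) (D : set S) (F : I -> (S -> bool) -> R) :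
  (forall i, depends_on D (F i)) -> depends_on D (fun z => \sum_(i <- r) F i z).
Proof. by move=> FD x z xz; apply: eq_bigr => i _; exact: FD. Qed.

Lemma depends_on_pattern V (s : {ffun V -> bool}) : depends_on [set` V] (pattern s).
Proof.
move=> x z xz; rewrite /pattern; congr ((_ == _)%:R).
by apply/ffunP => v; rewrite !ffunE xz//=; exact: valP.
Qed.

Lemma sum_pattern V (F : {ffun V -> bool} -> R) z :
  \sum_s F s * pattern s z = F (spins_on V z).
Proof.
rewrite (bigD1 (spins_on V z)) //= /pattern eqxx mulr1 big1 ?addr0 // => s.
by rewrite eq_sym => /negbTE ->; rewrite mulr0.
Qed.

Lemma cylinder_sum V f x0 : depends_on [set` V] f ->
  f = (fun z => \sum_(s : {ffun V -> bool}) f (glue x0 s) * pattern s z).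
Proof.
move=> fV; apply/funext => z; rewrite (@sum_pattern V (fun s => f (glue x0 s))).
by apply: fV => v /= vV; rewrite -[v]/(val [`vV]%fset) glue_in ffunE.
Qed.

Section operators.
Variables (L : {fset S} -> ((S -> bool) -> R) -> (S -> bool) -> R)
  (N : {fset S} -> {fset S}).
Hypothesis LN : spec_op L N.

Lemma opZ V (c : R) f x : L V (fun z => c * f z) x = c * L V f x.
Proof. by rewrite (@opM _ _ LN V f (fun=> c)). Qed.

Lemma op_cst V (c : R) x : L V (fun=> c) x = c.
Proof.
by rewrite -[RHS]mulr1 -(op1 LN V x) -opZ; congr L; apply/funext => z; rewrite mulr1.
Qed.

Lemma opN V f x : L V (fun z => - f z) x = - L V f x.
Proof. by rewrite -mulN1r -opZ; congr L; apply/funext => z; rewrite mulN1r. Qed.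

Lemma opB V f k x : L V (fun z => f z - k z) x = L V f x - L V k x.
Proof. by rewrite (opD LN) opN. Qed.

Lemma op_le V f k x : (forall z, f z <= k z) -> L V f x <= L V k x.
Proof. by move=> fk; rewrite -subr_ge0 -opB (op_ge0 LN)// => z; rewrite subr_ge0. Qed.

Lemma op_sum (I : Type) (r : seq I) V (F : I -> (S -> bool) -> R) x :
  L V (fun z => \sum_(i <- r) F i z) x = \sum_(i <- r) L V (F i) x.
Proof.
elim: r => [|i r IH]; first by under eq_fun do rewrite big_nil; rewrite big_nil op_cst.
by under eq_fun do rewrite big_cons; rewrite (opD LN) IH big_cons.
Qed.

Lemma op_off V f : depends_on (~` [set` V]) (L V f).
Proof.
apply: (depends_onW _ (op_depends LN (depends_onT f))).
by move=> v [].
Qed.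

(* Multiplying by the indicator of the event "z agrees with x off V", which only
   looks off V, does not change L V at x. *)
Lemma op_local V f k x : (forall z, (forall v, v \notin V -> z v = x v) -> f z = k z) ->
  L V f x = L V k x.
Proof.
move=> fk; pose e z : R := `[< forall v, v \notin V -> z v = x v >]%:R.
have eV : depends_on (~` [set` V]) e.
  move=> y z yz; congr (_%:R); congr nat_of_bool; apply: asbool_equiv_eq; split=> h v vV.
    by rewrite -yz ?h//=; apply/negP.
  by rewrite yz ?h//=; apply/negP.
have ex : e x = 1 by rewrite /e asboolT.
rewrite -[LHS]mul1r -[RHS]mul1r -ex -!(opM LN)//; congr L; apply/funext => z.
rewrite /e; case: asboolP => [/fk ->//|_]; by rewrite !mul0r.
Qed.

(** Only finitely many configurations agree with [x] off [V], so [L V] at [x] is a finite sum, for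
    measurable and other functions alike. The coefficients are cylinder functions of [x], from which
    measurability of [L V f] is later deduced. *)
Lemma op_pattern V f x :
  L V f x = \sum_(s : {ffun V -> bool}) L V (pattern s) x * f (glue x s).
Proof.
under eq_bigr do rewrite mulrC -opZ.
rewrite -op_sum; apply: op_local => z zx.
by rewrite (@sum_pattern V (fun s => f (glue x s))) spins_onK.
Qed.

End operators.

(** * Tilting an operator by a product weight *)

Definition weight (h : S -> bool -> R) V : (S -> bool) -> R :=
  fun z => \prod_(v <- V) h v (z v).

(** For [h v s] the likelihood of an observation y_v given the spin [s], this is gamma^y_V by Bayes'
    formula. General [h] are kept because the weights are switched on site by site. *)
Definition tilt (h : S -> bool -> R)
    (L : {fset S} -> ((S -> bool) -> R) -> (S -> bool) -> R) V f x :=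
  L V (fun z => weight h V z * f z) x / L V (weight h V) x.

Definition positive_tilt (h : S -> bool -> R) := forall v s, 0 < h v s.

Lemma weight_gt0 h V z : positive_tilt h -> 0 < weight h V z.
Proof. by move=> h0; apply: prodr_gt0 => v _; exact: h0. Qed.

Lemma depends_on_weight h V : depends_on [set` V] (weight h V).
Proof.
by move=> x z xz; apply: eq_big_seq => v vV; rewrite xz.
Qed.

Arguments depends_on_weight : clear implicits.

Lemma weightD h V W z : (W `<=` V)%fset ->
  weight h V z = weight h W z * weight h (V `\` W)%fset z.
Proof.
move=> WV; rewrite /weight (big_fsetID _ [in W])/=; congr (_ * _); apply: eq_fbigl => v.
- by rewrite !inE/= andb_idl// => /(fsubsetP WV).
- by rewrite !inE/= andbC.
Qed.

(** Positivity of [L] yields weak inequalities only. A weight is a finite product of positive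
    two-valued factors, hence bounded below by a positive constant, and [L] preserves that bound. *)
Lemma op_weight_gt0 L N h V x : spec_op L N -> positive_tilt h ->
  0 < L V (weight h V) x.
Proof.
move=> LN h0; have [c c0 hc] : exists2 c : R, 0 < c & forall z, c <= weight h V z.
  exists (\prod_(v <- V) Num.min (h v true) (h v false)).
    by apply: prodr_gt0 => v _; rewrite lt_min !h0.
  move=> z; apply: ler_prod => v _; apply/andP; split.
    by rewrite le_min !ltW ?h0.
  by case: (z v); rewrite ge_min lexx ?orbT.
by apply: (lt_le_trans c0); rewrite -[leLHS](op_cst LN V c x); exact: (op_le LN).
Qed.

(** The point is consistency. The weight of [V] splits into those of [W] and of [V \ W]; the latter,
    as well as the tilted mean over [W], looks only off [W] and comes out of [L W], where the inner
    normaliser cancels. *)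
Lemma spec_op_tilt L N h : spec_op L N -> positive_tilt h -> spec_op (tilt h L) N.
Proof.
move=> LN h0.
have Zneq0 V x : L V (weight h V) x != 0 by rewrite gt_eqF// (op_weight_gt0 _ _ LN).
split.
- move=> V f k x; rewrite /tilt -mulrDl -(opD LN); congr (L _ _ _ / _).
  by apply/funext => z; rewrite mulrDr.
- move=> V f x f0; apply: divr_ge0; apply: (op_ge0 LN) => z; last exact/ltW/weight_gt0.
  by rewrite mulr_ge0// ltW// weight_gt0.
- move=> V x; rewrite /tilt; under eq_fun do rewrite mulr1.
  by rewrite divff.
- move=> V f k x kV; rewrite /tilt mulrA -(opM LN)//; congr (L _ _ _ / _).
  by apply/funext => z; rewrite mulrCA.
- move=> V D f fD x z xz; rewrite /tilt.
  have wV : depends_on (D `|` [set` V]) (weight h V).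
    by apply: (depends_onW _ (depends_on_weight h V)) => v; right.
  congr (_ / _).
    apply: (op_depends LN (depends_onM wV (depends_onW _ fD))) => [v|v]; first by left.
    by move=> [[[|//]|] ? ?]; apply: xz; split=> //; [left|right].
  apply: (op_depends LN (depends_on_weight h V)) => v [[//|?] ?].
  by apply: xz; split=> //; right.
- move=> V W f x WV.
  have off f' : depends_on (~` [set` W]) f' ->
      forall z, L W (fun z => weight h W z * f' z) z = f' z * L W (weight h W) z.
    by move=> fW z; rewrite -(opM LN)//; congr L; apply/funext => y; rewrite mulrC.
  have wVW : depends_on (~` [set` W]) (weight h (V `\` W)%fset).
    apply: (depends_onW _ (depends_on_weight _ _)) => v /=; rewrite !inE => /andP[vW _].
    exact/negP.
  rewrite {1 3}/tilt; congr (_ / _).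
  rewrite -(opK LN _ _ WV) -[RHS](opK LN _ _ WV); congr L; apply/funext => z.
  transitivity (L W (fun y => weight h W y * (weight h (V `\` W)%fset y * tilt h L W f y)) z).
    by congr L; apply/funext => y; rewrite (weightD _ _ WV) mulrA.
  rewrite off; last first.
    apply: depends_onM => // y y' yy'; rewrite /tilt.
    by congr (_ / _); exact: (op_off LN).
  rewrite /tilt -!mulrA mulVf// mulr1 -(opM LN)//; congr L; apply/funext => y.
  by rewrite (weightD _ _ WV) mulrA; congr (_ * _); rewrite mulrC.
Qed.

Lemma tilt_tilt L N h (k : S -> bool -> R) V f x : spec_op L N -> positive_tilt k ->
  tilt h (tilt k L) V f x = tilt (fun v s => h v s * k v s) L V f x.
Proof.
move=> LN k0; rewrite /tilt.
have wM z : weight (fun v s => h v s * k v s) V z = weight k V z * weight h V z.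
  by rewrite /weight big_split mulrC.
rewrite invfM invrK mulrACA mulVf ?gt_eqF ?(op_weight_gt0 _ _ LN)//.
rewrite mulr1; congr (L _ _ _ / L _ _ _); apply/funext => z.
  by rewrite wM mulrA.
by rewrite wM.
Qed.

Lemma eq_tilt L h (k : S -> bool -> R) V f x : {in V, h =1 k} -> tilt h L V f x = tilt k L V f x.
Proof.
move=> hk; have hkE : weight h V = weight k V.
  by apply/funext => z; apply: eq_big_seq => v vV; rewrite hk.
by rewrite /tilt hkE.
Qed.

Lemma tilt1 L N V f x : spec_op L N -> tilt (fun _ _ => 1) L V f x = L V f x.
Proof.
move=> LN; rewrite /tilt.
have -> : weight (fun _ _ => 1) V = fun=> 1 by apply/funext => z; rewrite /weight big1.
by rewrite (op1 LN) divr1; congr L; apply/funext => z; rewrite mul1r.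
Qed.

(** * Stochastic comparison of tilted operators *)

Definition dominated (L L' : {fset S} -> ((S -> bool) -> R) -> (S -> bool) -> R) :=
  forall V f x x', increasing f -> spin_le x x' -> L V f x <= L' V f x'.

(** The likelihood-ratio order, with denominators cleared. *)
Definition tilt_le (h h' : S -> bool -> R) :=
  forall v, h v true * h' v false <= h' v true * h v false.

Definition update x u b : S -> bool := fun v => if v == u then b else x v.

Lemma spin_le_update x x' u (b b' : bool) : spin_le x x' -> b ==> b' ->
  spin_le (update x u b) (update x' u b').
Proof. by move=> xx' bb' v; rewrite /update; case: eqP. Qed.

Lemma spin_le_refl x : spin_le x x. Proof. by move=> v; case: (x v). Qed.

(* A two-point mean is F0 + theta (F1 - F0), where theta is monotone in the tilted
   weight of the point 1. *)
Lemma tilted_mean_le (a0 a1 b0 b1 h0 h1 k0 k1 F0 F1 G0 G1 : R) :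
  0 <= a0 -> 0 <= a1 -> 0 <= b0 -> 0 <= b1 -> a0 + a1 = 1 -> b0 + b1 = 1 ->
  0 < h0 -> 0 < h1 -> 0 < k0 -> 0 < k1 -> a1 <= b1 -> h1 * k0 <= k1 * h0 ->
  F0 <= F1 -> F0 <= G0 -> F1 <= G1 ->
  (h1 * (a1 * F1) + h0 * (a0 * F0)) / (h1 * a1 + h0 * a0)
  <= (k1 * (b1 * G1) + k0 * (b0 * G0)) / (k1 * b1 + k0 * b0).
Proof.
move=> a0_ a1_ b0_ b1_ aE bE h0_ h1_ k0_ k1_ ab hk F01 FG0 FG1.
have den (c0 c1 l0 l1 : R) : 0 <= c0 -> 0 <= c1 -> c0 + c1 = 1 -> 0 < l0 -> 0 < l1 ->
    0 < l1 * c1 + l0 * c0.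
  move=> c0_ c1_ cE l0_ l1_; have [c1p|c1p] := ltP 0 c1.
    by rewrite ltr_wpDr ?mulr_gt0// mulr_ge0// ltW.
  by rewrite ltr_wpDl// ?mulr_gt0 ?mulr_ge0//; lra.
have ha := den _ _ _ _ a0_ a1_ aE h0_ h1_.
have hb := den _ _ _ _ b0_ b1_ bE k0_ k1_.
apply: (@le_trans _ _ ((k1 * (b1 * F1) + k0 * (b0 * F0)) / (k1 * b1 + k0 * b0))); last first.
  rewrite ler_pM2r ?invr_gt0//; apply: lerD.
    by rewrite ler_pM2l// ler_wpM2l.
  by rewrite ler_pM2l// ler_wpM2l.
rewrite ler_pdivrMr// mulrAC ler_pdivlMr//.
rewrite -subr_ge0.
have -> : (k1 * (b1 * F1) + k0 * (b0 * F0)) * (h1 * a1 + h0 * a0) -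
   (h1 * (a1 * F1) + h0 * (a0 * F0)) * (k1 * b1 + k0 * b0)
   = (F1 - F0) * ((k1 * h0) * (b1 * a0) - (h1 * k0) * (a1 * b0)) by ring.
rewrite mulr_ge0 ?subr_ge0//.
apply: ler_pM => //; [by rewrite mulr_ge0// ltW|exact: mulr_ge0|].
by apply: ler_pM => //; lra.
Qed.

Definition tilt_at (h : S -> bool -> R) u : S -> bool -> R :=
  fun v s => if v == u then h v s else 1.

Lemma tilt_at_out L N h u V f x : spec_op L N -> u \notin V ->
  tilt (tilt_at h u) L V f x = L V f x.
Proof.
move=> LN uV; rewrite -(tilt1 V f x LN); apply: eq_tilt => v vV; apply/funext => s.
by rewrite /tilt_at; case: eqP => // vu; rewrite -vu vV in uV.
Qed.

(** Under [L V] at [x], the configuration off [V \ u] is [x] except for its spin at [u], so the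
    inner mean over [V \ u] takes just two values. *)
Lemma op_site L N (h : bool -> R) u V f x : spec_op L N -> u \in V ->
  L V (fun z => h (z u) * f z) x =
  h true * (L V (fun z => (z u)%:R) x * L (V `\ u)%fset f (update x u true))
  + h false * (L V (fun z => (~~ z u)%:R) x * L (V `\ u)%fset f (update x u false)).
Proof.
move=> LN uV; rewrite -(opK LN _ _ (fsubsetDl V [fset u]%fset)).
have off z : L (V `\ u)%fset (fun z => h (z u) * f z) z = h (z u) * L (V `\ u)%fset f z.
  apply: (@opM _ _ LN _ f (fun z => h (z u)) z) => y y' yy'; congr h; apply: yy' => /=.
  by rewrite !inE eqxx.
rewrite (funext off).
set F1 := L (V `\ u)%fset f (update x u true).
set F0 := L (V `\ u)%fset f (update x u false).
transitivity (L V (fun z => h true * F1 * (z u)%:R + h false * F0 * (~~ z u)%:R) x).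
  apply: (op_local LN) => z zx.
  have -> : L (V `\ u)%fset f z = L (V `\ u)%fset f (update x u (z u)).
    apply: (op_off LN) => v /=; rewrite /update !inE => vuV.
    case: eqP vuV => [->//|vu]; rewrite /= => vV; rewrite zx//; exact/negP.
  by rewrite /F1 /F0; case: (z u); rewrite /= !(mulr0, mulr1, addr0, add0r).
by rewrite (opD LN) !(opZ LN) -!mulrA [F1 * _]mulrC [F0 * _]mulrC.
Qed.

Lemma tilt_atE L N h u V f x : spec_op L N -> u \in V -> tilt (tilt_at h u) L V f x =
  (h u true * (L V (fun z => (z u)%:R) x * L (V `\ u)%fset f (update x u true))
  + h u false * (L V (fun z => (~~ z u)%:R) x * L (V `\ u)%fset f (update x u false))) /
  (h u true * L V (fun z => (z u)%:R) x + h u false * L V (fun z => (~~ z u)%:R) x).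
Proof.
move=> LN uV; rewrite /tilt.
have wE z : weight (tilt_at h u) V z = h u (z u).
  rewrite /weight (big_fsetD1 u)//= /tilt_at eqxx big_seq big1 ?mulr1// => v.
  by rewrite !inE; case: eqP.
under [X in L V X]eq_fun do rewrite wE.
rewrite (op_site (h u) f x LN uV).
congr (_ / _).
rewrite (_ : weight _ _ = fun z => h u (z u) * 1); last first.
  by apply/funext => z; rewrite wE mulr1.
by rewrite (op_site (h u) (fun=> 1) x LN uV) !(op1 LN) !mulr1.
Qed.

Lemma increasing_spin u : increasing (fun z => (z u)%:R : R).
Proof. by move=> x z xz; rewrite ler_nat; move: (xz u); case: (x u); case: (z u). Qed.

(** The tilt touches only [u]: once the spin there is given, the means over [V \ u] are untilted and
    ordered by the domination hypotheses. The same hypotheses order the marginals at [u], a spin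
    being an increasing function. *)
Lemma dominated_tilt_at L L' N N' h h' u : spec_op L N -> spec_op L' N' ->
  dominated L L -> dominated L L' ->
  positive_tilt h -> positive_tilt h' -> tilt_le h h' ->
  dominated (tilt (tilt_at h u) L) (tilt (tilt_at h' u) L').
Proof.
move=> LN LN' LL LL' h0 h'0 hh' V f x x' finc xx'.
have [uV|uV] := boolP (u \in V); last first.
  by rewrite (tilt_at_out h _ _ LN uV) (tilt_at_out h' _ _ LN' uV) LL'.
have sumE M K y : spec_op M K ->
    M V (fun z => (~~ z u)%:R) y + M V (fun z => (z u)%:R) y = 1.
  move=> MK; rewrite -(opD MK) -[RHS](op1 MK V y); congr M; apply/funext => z.
  by case: (z u); rewrite ?addr0 ?add0r.
rewrite (tilt_atE _ _ _ LN uV) (tilt_atE _ _ _ LN' uV); apply: tilted_mean_le => //;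
  try by [apply: (op_ge0 LN)|apply: (op_ge0 LN')|apply: sumE].
- exact: (sumE _ _ _ LN).
- exact: (sumE _ _ _ LN').
- exact: LL' (increasing_spin u) xx'.
- by apply: LL => //; apply: spin_le_update => //; exact: spin_le_refl.
- by apply: LL' => //; apply: spin_le_update.
- by apply: LL' => //; apply: spin_le_update.
Qed.

Definition tilt_on (h : S -> bool -> R) (us : seq S) : S -> bool -> R :=
  fun v s => if v \in us then h v s else 1.

(** The induction is over [us] for all pairs of tilts. Adding a site requires the partly tilted
    operator to dominate itself as well as to be dominated by the other one, so the induction
    hypothesis is used for the pair ([h], [h]) and for ([h], [h']). A repeated site adds nothing to
    [tilt_on]. *)
Lemma dominated_tilt_on L N h h' us : spec_op L N -> dominated L L ->
  positive_tilt h -> positive_tilt h' -> tilt_le h h' ->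
  dominated (tilt (tilt_on h us) L) (tilt (tilt_on h' us) L).
Proof.
move=> LN LL.
have pos (k : S -> bool -> R) vs : positive_tilt k -> positive_tilt (tilt_on k vs).
  by move=> k0 v s; rewrite /tilt_on; case: ifP.
elim: us h h' => [|u us IH] h h' h0 h'0 hh' V f x x' finc xx'.
  by rewrite !(@eq_tilt _ (tilt_on _ [::]) (fun _ _ => 1))// !(tilt1 _ _ _ LN) LL.
have [uus|uus] := boolP (u \in us).
  have E (k : S -> bool -> R) : tilt_on k (u :: us) = tilt_on k us.
    apply/funext => v; apply/funext => s; rewrite /tilt_on inE.
    by case: eqP => // ->; rewrite uus.
  by rewrite !E; exact: IH.
have E (k : S -> bool -> R) M : spec_op M N -> positive_tilt k -> tilt (tilt_on k (u :: us)) M V f =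
    tilt (tilt_at k u) (tilt (tilt_on k us) M) V f.
  move=> MN k0; apply/funext => y; rewrite (tilt_tilt _ _ _ _ MN); last exact: pos.
  congr (tilt _ M V f y); apply/funext => v; apply/funext => s.
  rewrite /tilt_on /tilt_at inE; case: eqP => [->|_ /=]; last by rewrite mul1r.
  by rewrite (negbTE uus) mulr1.
rewrite !E//; apply: (@dominated_tilt_at _ _ N N) => //.
- exact: spec_op_tilt (pos _ _ h0).
- exact: spec_op_tilt (pos _ _ h'0).
- by apply: IH => // v; rewrite mulrC.
- exact: IH.
Qed.

Lemma dominated_tilt L N h h' : spec_op L N -> dominated L L ->
  positive_tilt h -> positive_tilt h' -> tilt_le h h' ->
  dominated (tilt h L) (tilt h' L).
Proof.
move=> LN LL h0 h'0 hh' V f x x' finc xx'.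
have E (k : S -> bool -> R) y : tilt k L V f y = tilt (tilt_on k V) L V f y.
  by apply: eq_tilt => v vV; apply/funext => s; rewrite /tilt_on vV.
by rewrite (E h) (E h'); exact: (@dominated_tilt_on L N h h' V LN LL).
Qed.

(** * Extreme boundary conditions and the gap *)

Definition top : S -> bool := fun=> true.
Definition bottom : S -> bool := fun=> false.

Lemma spin_le_top x : spin_le x top. Proof. by move=> v; exact: implybT. Qed.
Lemma spin_bottom_le x : spin_le bottom x. Proof. by []. Qed.

Definition gap (L : {fset S} -> ((S -> bool) -> R) -> (S -> bool) -> R) W v : R :=
  L W (fun z => (z v)%:R) top - L W (fun z => (z v)%:R) bottom.

Definition count_on V : (S -> bool) -> R := fun z => \sum_(v <- V) (z v)%:R.

Lemma increasing_count_on V : increasing (count_on V).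
Proof. by move=> x z xz; apply: ler_sum => v _; exact: increasing_spin. Qed.

Lemma depends_on_count_on V : depends_on [set` V] (count_on V).
Proof. by move=> x z xz; apply: eq_big_seq => v vV; rewrite xz. Qed.

(** Raising at least one spin of [V] adds at least 1 to the count, which makes up for a drop of [f]
    by at most 1; if no spin of [V] changes, neither does the sum. *)
Lemma increasing_add_count_on V f : depends_on [set` V] f ->
  (forall x z, f x - f z <= 1) -> increasing (fun z => f z + count_on V z).
Proof.
move=> fV f1 x z xz.
have [/existsP[v]|/existsPn h] := boolP [exists v : V, (x (val v)) != z (val v)].
  move=> xzv.
  have {xzv}[xv zv] : x (val v) = false /\ z (val v) = true.
    by move: xzv (xz (val v)); case: (x _); case: (z _).
  have : count_on V x + 1 <= count_on V z.
    rewrite /count_on !(big_fsetD1 (val v) (valP v))/= xv zv mulr0n mulr1n add0r.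
    rewrite [leLHS]addrC lerD2l.
    by apply: ler_sum => u _; exact: increasing_spin.
  by move: (f1 x z); lra.
have xzV v : [set` V] v -> x v = z v.
  by move=> vV; have := h [`vV]%fset; rewrite negbK => /eqP.
by rewrite (fV x z)// (depends_on_count_on xzV).
Qed.

Section gap.
Variables (L : {fset S} -> ((S -> bool) -> R) -> (S -> bool) -> R)
  (N : {fset S} -> {fset S}).
Hypothesis LN : spec_op L N.
Hypothesis Lmono : dominated L L.

Lemma gap_ge0 W v : 0 <= gap L W v.
Proof. by rewrite subr_ge0; apply: Lmono => //; exact: increasing_spin. Qed.

(** Inside the larger volume the boundary of [V] is random: [L W f] is the [L W]-mean of [L V f],
    which is nowhere larger than at [top]. *)
Lemma op_top_antitone V W f : (V `<=` W)%fset -> increasing f ->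
  L W f top <= L V f top.
Proof.
move=> VW finc; rewrite -(opK LN _ _ VW) -[leRHS](op_cst LN W _ top).
by apply: (op_le LN) => z; exact: Lmono (spin_le_top z).
Qed.

Lemma op_bottom_monotone V W f : (V `<=` W)%fset -> increasing f ->
  L V f bottom <= L W f bottom.
Proof.
move=> VW finc; rewrite -(opK LN _ _ VW) -[leLHS](op_cst LN W _ bottom).
by apply: (op_le LN) => z; exact: Lmono (spin_bottom_le z).
Qed.

Lemma gap_antitone V W v : (V `<=` W)%fset -> gap L W v <= gap L V v.
Proof.
move=> VW; apply: lerB; first exact: op_top_antitone (increasing_spin v).
exact: op_bottom_monotone (increasing_spin v).
Qed.

Lemma sum_gap V W : \sum_(v <- V) gap L W v =
  L W (count_on V) top - L W (count_on V) bottom.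
Proof. by rewrite /count_on !(op_sum LN) -sumrB. Qed.

(** Comparing [x] with [top] for both [f + count_on V] and [- f + count_on V] bounds the distance by
    the increase of the mean count from [x] to [top], hence by its increase from [bottom] to
    [top]. *)
Lemma op_top_dist V W f x : depends_on [set` V] f -> (forall x z, f x - f z <= 1) ->
  `|L W f x - L W f top| <= \sum_(v <- V) gap L W v.
Proof.
move=> fV f1; rewrite sum_gap.
have inc1 := increasing_add_count_on fV f1.
have inc2 : increasing (fun z => - f z + count_on V z).
  apply: increasing_add_count_on => [|y z]; first exact: depends_onN.
  by rewrite opprK addrC.
have := Lmono W inc1 (spin_le_top x); have := Lmono W inc2 (spin_le_top x).
rewrite !(opD LN) !(opN LN).
have := Lmono W (@increasing_count_on V) (spin_bottom_le x).
by rewrite ler_norml; lra.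
Qed.

End gap.

(* The mean of [f] at the configuration equal to [y] off [l] and, on [l], to the
   observation of [x] through the independent channels [g v (x v)]; one site is
   integrated at a time so that monotonicity is an immediate induction. *)
Fixpoint noise (g : S -> bool -> bool -> R) (l : seq S) f x y : R :=
  if l is u :: l' then
    g u (x u) true * noise g l' f x (update y u true)
    + g u (x u) false * noise g l' f x (update y u false)
  else f y.

(** Positivity keeps the normalisers away from 0. The last clause, which for [obs_density] is p_v <=
    1/2, enters twice: it makes the observations increase with the hidden spins, and the posterior
    increase with the observations. *)
Definition channel (g : S -> bool -> bool -> R) :=
  [/\ forall v s t, 0 < g v s t, forall v s, g v s true + g v s false = 1
    & forall v, g v false true <= g v true true].

Lemma noise_le g l f x x' y y' : channel g -> increasing f -> spin_le x x' ->
  spin_le y y' -> noise g l f x y <= noise g l f x' y'.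
Proof.
move=> [g0 g1 gle] finc.
elim: l x x' y y' => [|u l IH] x x' y y' xx' yy' /=; first exact: finc.
have gE s : g u s false = 1 - g u s true by rewrite -(g1 u s); lra.
have h1 : noise g l f x (update y u true) <= noise g l f x' (update y' u true).
  by apply: IH => //; exact: spin_le_update.
have h0 : noise g l f x (update y u false) <= noise g l f x' (update y' u false).
  by apply: IH => //; exact: spin_le_update.
have h01 : noise g l f x' (update y' u false) <= noise g l f x' (update y' u true).
  by apply: IH => //; [exact: spin_le_refl|apply: spin_le_update => //; exact: spin_le_refl].
(* The weights are still those of [x], the values already those of [x'] and [y']. What remains is a
   two-point mean whose weight moves towards the larger value. *)
apply: (@le_trans _ _ (g u (x u) true * noise g l f x' (update y' u true)
    + g u (x u) false * noise g l f x' (update y' u false))).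
  by apply: lerD; rewrite ler_pM2l.
rewrite !gE; set A := noise _ _ _ _ _; set B := noise _ _ _ _ _.
have : 0 <= (g u (x' u) true - g u (x u) true) * (A - B).
  rewrite mulr_ge0 ?subr_ge0//.
  by have := xx' u; case: (x u); case: (x' u).
lra.
Qed.

(** The factor [k] is there for the induction: it absorbs the factor of the site split off from the
    product. *)
Lemma noise_prod g l (c : S -> bool -> R) k x y : uniq l ->
  depends_on (~` [set` l]) k ->
  noise g l (fun y => k y * \prod_(v <- l) c v (y v)) x y =
  k y * \prod_(v <- l) (g v (x v) true * c v true + g v (x v) false * c v false).
Proof.
elim: l k y => [|u l IH] k y /=; first by rewrite !big_nil.
move=> /andP[ul ll] kl.
have E : (fun y => k y * \prod_(v <- u :: l) c v (y v)) =
         (fun y => (k y * c u (y u)) * \prod_(v <- l) c v (y v)).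
  by apply/funext => z; rewrite big_cons mulrA.
have kl' : depends_on (~` [set` l]) (fun y => k y * c u (y u)).
  move=> z z' zz'; rewrite (kl z z') ?zz'//=; first exact/negP.
  by move=> v /= vl; apply: zz' => /= vl'; apply: vl; rewrite inE vl' orbT.
have ku b : k (update y u b) = k y.
  apply: kl => v /= vl; rewrite /update; case: eqP => // vu.
  by exfalso; apply: vl; rewrite vu inE eqxx.
by rewrite E !IH// big_cons !ku /update eqxx; ring.
Qed.

Lemma noiseD g l f k x y :
  noise g l (fun z => f z + k z) x y = noise g l f x y + noise g l k x y.
Proof. by elim: l y => //= u l IH y; rewrite !IH; ring. Qed.

Lemma noiseZ g l (c : R) f x y :
  noise g l (fun z => c * f z) x y = c * noise g l f x y.
Proof. by elim: l y => //= u l IH y; rewrite !IH; ring. Qed.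

Lemma noise_sum (I : Type) (r : seq I) g l (F : I -> (S -> bool) -> R) x y :
  noise g l (fun z => \sum_(i <- r) F i z) x y = \sum_(i <- r) noise g l (F i) x y.
Proof.
elim: r => [|i r IH].
  rewrite big_nil (_ : (fun z => _) = fun z => 0 * 0); first by rewrite noiseZ mul0r.
  by apply/funext => z; rewrite big_nil mul0r.
by under eq_fun do rewrite big_cons; rewrite noiseD IH big_cons.
Qed.

Definition likelihood (g : S -> bool -> bool -> R) y : S -> bool -> R :=
  fun v s => g v s (y v).

Lemma pattern_prod U (s : {ffun U -> bool}) x0 z :
  pattern s z = \prod_(v <- U) (z v == glue x0 s v)%:R.
Proof.
rewrite /pattern; case: eqP => [<-|ne].
  rewrite big_seq big1// => v vU.
  by rewrite -[v in glue _ _ v]/(val [`vU]%fset) glue_in ffunE eqxx.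
have [v zv] : exists v : U, z (val v) != s v.
  apply/existsP; apply: contra_notT ne => /existsPn h; apply/ffunP => v.
  by rewrite ffunE; apply/eqP; rewrite -[_ == _]negbK.
by rewrite (big_fsetD1 (val v) (valP v))/= glue_in (negbTE zv) mul0r.
Qed.

(** The link between two forms of one mean: the recursion suits monotonicity, the sum over observed
    patterns weighted by their likelihoods suits the joint law of (X, Y). *)
Lemma noiseE g U f x x0 y0 : depends_on [set` U] f -> noise g U f x y0 =
  \sum_(t : {ffun U -> bool}) f (glue x0 t) * weight (likelihood g (glue x0 t)) U x.
Proof.
move=> fU; rewrite {1}(cylinder_sum x0 fU) noise_sum; apply: eq_bigr => t _.
rewrite noiseZ; congr (_ * _).
transitivity (noise g U (fun z => 1 * \prod_(v <- U) (z v == glue x0 t v)%:R) x y0).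
  by congr noise; apply/funext => z; rewrite (pattern_prod t x0) mul1r.
rewrite (@noise_prod g U (fun v b => (b == glue x0 t v)%:R) (fun=> 1))//.
rewrite mul1r; apply: eq_bigr => v _; rewrite /likelihood.
by case: (glue x0 t v); rewrite /= ?(mulr0, mulr1, addr0, add0r).
Qed.

Lemma sum_likelihood g U x x0 : channel g ->
  \sum_(t : {ffun U -> bool}) weight (likelihood g (glue x0 t)) U x = 1.
Proof.
move=> [g0 g1 _]; transitivity (noise g U (fun=> 1) x x0).
  by rewrite (noiseE _ _ x0)//; apply: eq_bigr => t _; rewrite mul1r.
by elim: (U : seq S) x0 => //= u l IH x0; rewrite !IH !mulr1.
Qed.

Lemma channel_tilt_le g y y' : channel g -> spin_le y y' ->
  tilt_le (likelihood g y) (likelihood g y').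
Proof.
move=> [g0 g1 gle] yy' v; rewrite /likelihood.
have gE s : g v s false = 1 - g v s true by rewrite -(g1 v s); lra.
have := yy' v; case: (y v); case: (y' v) => //= _.
by rewrite !gE; have := gle v; lra.
Qed.

Lemma channel_positive g y : channel g -> positive_tilt (likelihood g y).
Proof. by move=> [g0 _ _] v s; exact: g0. Qed.

Lemma depends_on_tilt_obs L g W f x :
  depends_on [set` W] (fun y => tilt (likelihood g y) L W f x).
Proof.
move=> y y' yy'; apply: eq_tilt => v vW; apply/funext => s.
by rewrite /likelihood yy'.
Qed.

(* Averaging over the observations of a configuration drawn with boundary
   condition [x0] removes the conditioning. *)
Lemma op_noise_tilt L N g W f x0 : spec_op L N -> channel g ->
  L W (fun z => noise g W (fun y => tilt (likelihood g y) L W f x0) z top) x0 = L W f x0.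
Proof.
move=> LN gch.
under eq_fun => z do rewrite (noiseE _ _ top _ (@depends_on_tilt_obs L g W f x0)).
rewrite (op_sum LN).
(* The probability of observing [t] under [L W] at [x0] is the normaliser of the posterior given
   [t], so the two cancel; the likelihoods left over sum to 1. *)
under eq_bigr => t _.
  rewrite (opZ LN) /tilt divfK; last first.
    by rewrite gt_eqF// (op_weight_gt0 _ _ LN)//; exact: channel_positive.
  over.
rewrite -(op_sum LN); congr L; apply/funext => z.
by rewrite -mulr_suml sum_likelihood// mul1r.
Qed.

Lemma increasing_noise g W f y : channel g -> increasing f ->
  increasing (fun z => noise g W f z y).
Proof. by move=> gch finc x z xz; apply: noise_le => //; exact: spin_le_refl. Qed.

End finite_volume.

(** * Bounded functions and coordinate events *)

Section mean.
Context {dT : measure_display} {T : measurableType dT} {R : realType}.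
Variable P : probability T R.
Implicit Types (f g : T -> R) (A C : set T).

Definition bounded_mfun f :=
  measurable_fun [set: T] f /\ exists M : R, forall w, `|f w| <= M.

Lemma bounded_mfun_cst (c : R) : bounded_mfun (fun=> c).
Proof. by split=> //; exists `|c|. Qed.

Lemma bounded_mfunD f g : bounded_mfun f -> bounded_mfun g ->
  bounded_mfun (fun w => f w + g w).
Proof.
move=> [mf [M fM]] [mg [K gK]]; split; first exact: measurable_funD.
by exists (M + K) => w; rewrite (le_trans (ler_normD _ _))// lerD.
Qed.

Lemma bounded_mfunM f g : bounded_mfun f -> bounded_mfun g ->
  bounded_mfun (fun w => f w * g w).
Proof.
move=> [mf [M fM]] [mg [K gK]]; split; first exact: measurable_funM.
by exists (M * K) => w; rewrite normrM ler_pM.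
Qed.

Lemma bounded_mfunZ (c : R) f : bounded_mfun f -> bounded_mfun (fun w => c * f w).
Proof. by move=> bf; apply: bounded_mfunM => //; exact: bounded_mfun_cst. Qed.

Lemma bounded_mfunB f g : bounded_mfun f -> bounded_mfun g ->
  bounded_mfun (fun w => f w - g w).
Proof.
move=> bf bg; under eq_fun do rewrite -mulN1r.
by apply: bounded_mfunD => //; exact: bounded_mfunZ.
Qed.

Lemma bounded_mfun_indic A : measurable A -> bounded_mfun (\1_A : T -> R).
Proof.
move=> mA; split => //.
by exists 1 => w; rewrite indicE; case: (_ \in _); rewrite ?normr1 ?normr0.
Qed.

Lemma bounded_mfun_sum (I : Type) (r : seq I) (F : I -> T -> R) :
  (forall i, bounded_mfun (F i)) -> bounded_mfun (fun w => \sum_(i <- r) F i w).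
Proof.
move=> bF; elim: r => [|i r IH].
  by under eq_fun do rewrite big_nil; exact: bounded_mfun_cst.
by under eq_fun do rewrite big_cons; exact: bounded_mfunD.
Qed.

Lemma bounded_mfun_integrable f : bounded_mfun f -> P.-integrable [set: T] (EFin \o f).
Proof.
move=> [mf [M fM]]; apply: measurable_bounded_integrable => //.
  by rewrite (le_lt_trans (probability_le1 P measurableT))// ltry.
exists M; split; first exact: num_real.
by move=> x Mx w _ /=; rewrite (le_trans (fM w))// ltW.
Qed.

Lemma EFin_mean f : P.-integrable [set: T] (EFin \o f) ->
  (\int[P]_w f w)%:E = (\int[P]_w (f w)%:E)%E.
Proof. by move=> fi; rewrite fineK//; exact: integrable_fin_num. Qed.

Lemma mean_cst (c : R) : \int[P]_w c = c.
Proof.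
rewrite Rintegral_cst//; have /(congr1 fine) -> := probability_setT P.
by rewrite mulr1.
Qed.

Lemma mean_sum (I : Type) (r : seq I) (F : I -> T -> R) :
  (forall i, bounded_mfun (F i)) ->
  \int[P]_w (\sum_(i <- r) F i w) = \sum_(i <- r) \int[P]_w F i w.
Proof.
move=> bF; elim: r => [|i r IH].
  by under eq_Rintegral do rewrite big_nil; rewrite mean_cst big_nil.
under eq_Rintegral do rewrite big_cons.
rewrite RintegralD// ?IH ?big_cons//; apply: bounded_mfun_integrable => //.
exact: bounded_mfun_sum.
Qed.

Lemma mean_le f g : bounded_mfun f -> bounded_mfun g -> (forall w, f w <= g w) ->
  \int[P]_w f w <= \int[P]_w g w.
Proof. by move=> bf bg fg; apply: le_Rintegral => //; exact: bounded_mfun_integrable. Qed.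

Lemma mean_indic A : measurable A -> (\int[P]_w (\1_A w))%:E = P A.
Proof.
move=> mA; rewrite EFin_mean; first by rewrite integral_indic// setIT.
exact/bounded_mfun_integrable/bounded_mfun_indic.
Qed.

Lemma restrict_indicM f C w : ((EFin \o f) \_ C) w = (\1_C w * f w)%:E.
Proof. by rewrite patchE indicE; case: ifP; rewrite ?(mul1r, mul0r). Qed.

Lemma integrable_indicM C f : measurable C -> P.-integrable [set: T] (EFin \o f) ->
  P.-integrable [set: T] (EFin \o (fun w => \1_C w * f w)).
Proof.
move=> mC fi; have /(integrable_restrict P mC measurableT _).1 :
    P.-integrable ([set: T] `&` C) (EFin \o f).
  by apply: integrableS fi => //; exact: measurableI.
by apply: eq_integrable => // w _; rewrite restrict_indicM.
Qed.

Lemma integral_EFin_indic f C : measurable C -> P.-integrable [set: T] (EFin \o f) ->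
  (\int[P]_(w in C) (f w)%:E)%E = (\int[P]_w (\1_C w * f w))%:E.
Proof.
move=> mC fi; rewrite EFin_mean; last exact: integrable_indicM.
by rewrite integral_mkcond; apply: eq_integral => w _; exact: restrict_indicM.
Qed.

End mean.

(** * Sigma-algebras generated by families of spins *)

Section sigma_cylinder.
Context {T : pointedType} {I : choiceType}.
Implicit Types (Z : T -> I -> bool) (D : set I) (U : {fset I}).

(** These events form a pi-system, intersections being unions of the index sets, and since a spin
    has two values they generate the sigma-algebra of the family. *)
Definition up_cylinder Z U : set T := [set w | forall v, v \in U -> Z w v].

Definition up_cylinders Z D : set (set T) :=
  [set up_cylinder Z U | U in [set U : {fset I} | [set` U] `<=` D]].

Definition coordinate_fields Z D : set (set T) :=
  \bigcup_(v in D) preimage_set_system [set: T] (fun w => Z w v) measurable.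

Lemma up_cylinders_setI Z D : setI_closed (up_cylinders Z D).
Proof.
move=> _ _ [U /= UD <-] [V /= VD <-]; exists (U `|` V)%fset.
  by move=> v /=; rewrite in_fsetU => /orP[/UD|/VD].
rewrite /up_cylinder; apply/seteqP; split=> w /=.
  by move=> h; split=> v vUV; apply: h; rewrite in_fsetU vUV ?orbT.
by move=> [hU hV] v; rewrite in_fsetU => /orP[/hU|/hV].
Qed.

Lemma coordinate_fields_generated Z D :
  <<s coordinate_fields Z D >> = <<s up_cylinders Z D >>.
Proof.
pose TU := g_sigma_algebraType (up_cylinders Z D).
pose TC := g_sigma_algebraType (coordinate_fields Z D).
apply/seteqP; split; apply: smallest_sub; try exact: smallest_sigma_algebra.
  move=> _ [v Dv [B _ <-]]; rewrite setTI.
  have mv : <<s up_cylinders Z D >> [set w | Z w v].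
    apply: sub_sigma_algebra; exists [fset v]%fset => [u /=|]; first by rewrite inE => /eqP ->.
    apply/seteqP; split=> w /=; first by apply; rewrite inE.
    by move=> Zv u; rewrite inE => /eqP ->.
  have mCv : <<s up_cylinders Z D >> [set w | ~~ Z w v].
    rewrite (_ : [set w | _] = ~` [set w | Z w v]); first exact: sigma_algebraC.
    by apply/seteqP; split=> w /= /negP.
  have [Bt|Bt] := pselect (B true); have [Bf|Bf] := pselect (B false).
  - rewrite (_ : _ @^-1` B = setT); first exact: (@measurableT _ TU).
    by apply/seteqP; split=> w //= _; case: (Z w v).
  - rewrite (_ : _ @^-1` B = [set w | Z w v])//.
    by apply/seteqP; split=> w /=; case: (Z w v).
  - rewrite (_ : _ @^-1` B = [set w | ~~ Z w v])//.
    by apply/seteqP; split=> w /=; case: (Z w v).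
  - rewrite (_ : _ @^-1` B = set0); first exact: (@measurable0 _ TU).
    by apply/seteqP; split=> w //=; case: (Z w v).
move=> _ [U /= UD <-].
pose B v := [set w | v \in U -> Z w v].
rewrite (_ : up_cylinder Z U = \big[setI/setT]_(v <- U) [set w | Z w v]); last first.
  apply/seteqP; split=> w /=; rewrite -bigcap_seq.
    by move=> h v /=; exact: h.
  by move=> h v vU; exact: (h v).
rewrite big_seq; elim/big_ind: _.
- exact: (@measurableT _ TC).
- exact: (@measurableI _ TC).
- move=> v vU; apply: sub_sigma_algebra; exists v; first exact: UD.
by exists [set true] => //; rewrite setTI; apply/seteqP; split.
Qed.

End sigma_cylinder.

Section integral_unique.
Context {dT : measure_display} {T : measurableType dT} {R : realType} {I : choiceType}.
Variables (P : probability T R) (Z : T -> I -> bool) (D : set I).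
Hypothesis mZ : forall v, measurable [set w | Z w v].

Lemma measurable_up_cylinder U : measurable (up_cylinder Z U).
Proof.
rewrite (_ : up_cylinder Z U = \big[setI/setT]_(v <- U) [set w | Z w v]).
  by elim/big_ind : _ => //; exact: measurableI.
apply/seteqP; split=> w /=; rewrite -bigcap_seq.
  by move=> h v /=; exact: h.
by move=> h v vU; exact: (h v).
Qed.

Lemma measurable_coordinate_fields : <<s coordinate_fields Z D >> `<=` measurable.
Proof.
rewrite coordinate_fields_generated; apply: smallest_sub.
  exact: sigma_algebra_measurable.
by move=> _ [U _ <-]; exact: measurable_up_cylinder.
Qed.

(** Dynkin's lemma. The empty [U] gives equal total integrals, which complements require. *)
Lemma integral_coordinate_unique (f g : T -> \bar R) :
  P.-integrable [set: T] f -> P.-integrable [set: T] g ->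
  (forall U : {fset I}, [set` U] `<=` D ->
    \int[P]_(w in up_cylinder Z U) f w = \int[P]_(w in up_cylinder Z U) g w)%E ->
  forall A, <<s coordinate_fields Z D >> A ->
    (\int[P]_(w in A) f w = \int[P]_(w in A) g w)%E.
Proof.
move=> fi gi fg A; rewrite coordinate_fields_generated => sA.
have sub h B : measurable B -> P.-integrable setT h -> P.-integrable B h.
  by move=> mB; exact: integrableS.
suff: <<s up_cylinders Z D >> `<=` [set B | measurable B /\
    (\int[P]_(w in B) f w = \int[P]_(w in B) g w)%E].
  by move=> /(_ _ sA)[].
have fgT : (\int[P]_w f w = \int[P]_w g w)%E.
  have := @fg fset0; rewrite (_ : up_cylinder Z fset0 = setT); first by apply.
  by apply/seteqP; split.
apply: lambda_system_subset; [exact: up_cylinders_setI| | |by []].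
- apply/dynkin_lambda_system; split => //.
  + move=> B [mB fgB]; split; first exact: measurableC.
    have split_ h : P.-integrable setT h ->
        (\int[P]_(w in ~` B) h w = \int[P]_w h w - \int[P]_(w in B) h w)%E.
      move=> hi; rewrite -(setUv B) integral_setU//; last 3 first.
      * exact: measurableC.
      * by rewrite setUv; exact: measurable_int hi.
      * by apply/disj_setPRL.
      rewrite addeAC subee ?add0e//; apply: integrable_fin_num => //; exact: sub.
    by rewrite !split_// fgT fgB.
  + move=> F tF Fm; have mF n : measurable (F n) by case: (Fm n).
    have mU : measurable (\bigcup_k F k) by exact: bigcup_measurable.
    split=> //; rewrite !integral_bigcup//; [|exact: sub|exact: sub].
    by apply: eq_eseriesr => n _; case: (Fm n).
- move=> _ [U /= UD <-]; split; first exact: measurable_up_cylinder.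
  exact: fg.
Qed.

End integral_unique.

(** * Cylinder functions *)

Section cylinder_events.
Context {T : pointedType} {I : choiceType}.

Lemma coordinate_fields_spin (Z : T -> I -> bool) (D : set I) v b : D v ->
  <<s coordinate_fields Z D >> [set w | Z w v = b].
Proof.
move=> Dv; apply: sub_sigma_algebra; exists v => //; exists [set b] => //.
by rewrite setTI; apply/seteqP; split.
Qed.

Lemma coordinate_fields_spins_on (Z : T -> I -> bool) (D : set I) (U : {fset I})
    (s : {ffun U -> bool}) : [set` U] `<=` D ->
  <<s coordinate_fields Z D >> [set w | spins_on U (Z w) = s].
Proof.
move=> UD; rewrite (_ : [set w | _] = \big[setI/setT]_(v : U) [set w | Z w (val v) = s v]).
  elim/big_ind : _ => [||v _].
  - exact: (@measurableT _ (g_sigma_algebraType (coordinate_fields Z D))).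
  - exact: (@measurableI _ (g_sigma_algebraType (coordinate_fields Z D))).
  - by apply: coordinate_fields_spin; exact/UD/valP.
apply/seteqP; split=> w /=.
  by move=> <-; elim/big_ind : _ => [||v _] //= ; rewrite ffunE.
move=> h; apply/ffunP => v; rewrite ffunE.
by move: h; rewrite (bigD1 v)//= => -[].
Qed.

End cylinder_events.

Section cylinder_functions.
Context {R : realType} {d : nat}.
Implicit Types (U V : {fset site d}) (f : config d -> R).

Lemma measurable_spin v b : measurable [set x : config d | x v = b].
Proof. exact: (@coordinate_fields_spin _ _ (fun x : site d -> bool => x)). Qed.

Lemma measurable_spins_on U (s : {ffun U -> bool}) :
  measurable [set x : config d | spins_on U x = s].
Proof. exact: (@coordinate_fields_spins_on _ _ (fun x : site d -> bool => x)). Qed.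

Lemma measurable_to_config {dT : measure_display} {T : measurableType dT}
    (F : T -> config d) : (forall v, measurable [set t | F t v]) ->
  measurable_fun [set: T] F.
Proof.
move=> mF; apply: (@measurability _ _ T (config d) setT F (coordinate_events d)) => //.
move=> _ [_ [v _ [B mB <-]] <-]; rewrite !setTI -comp_preimage.
apply: (@measurable_coordinate_fields _ _ _ (fun t => F t) setT mF).
by apply: sub_sigma_algebra; exists v => //; exists B => //; rewrite setTI.
Qed.

Lemma pattern_indic U (s : {ffun U -> bool}) :
  pattern s = (\1_[set x : config d | spins_on U x = s] : _ -> R).
Proof.
apply/funext => x; rewrite /pattern indicE; congr (nat_of_bool _)%:R.
by apply/eqP/idP; [rewrite inE|rewrite inE].
Qed.

Lemma bounded_mfun_cylinder U f : depends_on [set` U] f ->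
  bounded_mfun (f : config d -> R).
Proof.
move=> fU; rewrite (cylinder_sum (@top _) fU); apply: bounded_mfun_sum => s.
rewrite pattern_indic; apply: bounded_mfunZ; apply: bounded_mfun_indic.
exact: measurable_spins_on.
Qed.

Definition cylinder f := exists U, depends_on [set` U] f.

Lemma cylinder_cst (c : R) : cylinder (fun=> c). Proof. by exists fset0. Qed.

Lemma cylinderM f g : cylinder f -> cylinder g -> cylinder (fun z => f z * g z).
Proof.
move=> [U fU] [V gV]; exists (U `|` V)%fset.
by apply: depends_onM; [apply: depends_onW fU|apply: depends_onW gV] => v /= vU;
  rewrite in_fsetU vU ?orbT.
Qed.

Lemma cylinderD f g : cylinder f -> cylinder g -> cylinder (fun z => f z + g z).
Proof.
move=> [U fU] [V gV]; exists (U `|` V)%fset.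
by apply: depends_onD; [apply: depends_onW fU|apply: depends_onW gV] => v /= vU;
  rewrite in_fsetU vU ?orbT.
Qed.

Lemma cylinderZ (c : R) f : cylinder f -> cylinder (fun z => c * f z).
Proof. by apply: cylinderM; exact: cylinder_cst. Qed.

Lemma cylinder_sum_fun (I : Type) (r : seq I) (F : I -> config d -> R) :
  (forall i, cylinder (F i)) -> cylinder (fun z => \sum_(i <- r) F i z).
Proof.
move=> FC; elim: r => [|i r IH].
  by under eq_fun do rewrite big_nil; exact: cylinder_cst.
by under eq_fun do rewrite big_cons; exact: cylinderD.
Qed.

Lemma depends_on_up_cylinder U :
  depends_on [set` U] (\1_(up_cylinder (fun x : config d => x) U) : config d -> R).
Proof.
move=> x z xz; rewrite !indicE; congr (nat_of_bool _)%:R.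
by apply/idP/idP; rewrite !inE => h v vU; [rewrite -xz ?h|rewrite xz ?h].
Qed.

Lemma cylinder_bounded_mfun f : cylinder f -> bounded_mfun f.
Proof. by move=> [U]; exact: bounded_mfun_cylinder. Qed.

Lemma cylinder_pattern U (s : {ffun U -> bool}) : cylinder (pattern s : config d -> R).
Proof. by exists U; exact: depends_on_pattern. Qed.

End cylinder_functions.

(** * Probabilities from positive functionals on cylinder functions *)

(* [code n t] is the n-th word of t in the subdivision of [0, 1[ in which the
   interval of a word s has length m s and is cut into those of s0 and s1. *)
Section nested_intervals.
Context {R : realType}.
Variable m : seq bool -> R.
Hypotheses (m1 : m [::] = 1) (m_ge0 : forall s, 0 <= m s)
  (mE : forall s, m s = m (rcons s false) + m (rcons s true)).

(** The total mass of the words of the same length that precede [s] lexicographically: each 1 of [s]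
    contributes the 0-branch to its left. *)
Definition left_end (s : seq bool) : R :=
  \sum_(i < size s | nth false s i) m (rcons (take i s) false).

Lemma left_end_rcons s b :
  left_end (rcons s b) = left_end s + (if b then m (rcons s false) else 0).
Proof.
rewrite /left_end size_rcons big_mkcond big_ord_recr/= -big_mkcond/=.
rewrite nth_rcons ltnn eqxx -cats1 take_size_cat//; congr (_ + _).
rewrite [in LHS]big_mkcond [in RHS]big_mkcond; apply: eq_bigr => i _.
rewrite nth_cat ltn_ord take_cat ltn_ord.
by [].
Qed.

Definition cut s : R := left_end s + m (rcons s false).

Fixpoint code n (t : R) : seq bool :=
  if n is n'.+1 then rcons (code n' t) (cut (code n' t) <= t) else [::].

Lemma size_code n t : size (code n t) = n.
Proof. by elim: n => //= n IH; rewrite size_rcons IH. Qed.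

(** Intervals are closed on the left and open on the right, and a point equal to the cut goes right.
    The intervals of the two extensions thus partition that of [s], even when one of them is
    empty. *)
Lemma code_itv s t : (0 <= t < 1 /\ code (size s) t = s) <->
  left_end s <= t < left_end s + m s.
Proof.
elim/last_ind: s t => [|s b IH] t.
  by rewrite /left_end big_ord0 m1 add0r; split=> [[]//|].
rewrite size_rcons/= left_end_rcons.
have H : (0 <= t < 1 /\ rcons (code (size s) t) (cut (code (size s) t) <= t) = rcons s b)
    <-> (left_end s <= t < left_end s + m s /\ (cut s <= t) = b).
  split=> [[t01 /rcons_inj[cs]]|].
    by rewrite cs => cb; split=> //; apply/IH.
  by move=> [/IH[t01 cs] cb]; split=> //; rewrite cs cb.
apply: (iff_trans H); rewrite (mE s) /cut.
have := m_ge0 (rcons s false); have := m_ge0 (rcons s true).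
set A := m (rcons s true); set B := m (rcons s false) => A0 B0.
case: b {H}; rewrite -?/A -?/B.
  split=> [[/andP[h1 h2] h3]|/andP[h1 h2]]; first by apply/andP; split; lra.
  by split; [apply/andP; split; lra|].
split=> [[/andP[h1 h2] /negbT]|/andP[h1 h2]].
  by rewrite -ltNge => h3; apply/andP; split; lra.
split; first by apply/andP; split; lra.
by apply/negbTE; rewrite -ltNge; lra.
Qed.

Lemma nth_code n t k : (k < n)%N -> nth false (code n t) k = (cut (code k t) <= t).
Proof.
elim: n => //= n IH; rewrite ltnS leq_eqVlt => /orP[/eqP ->|kn].
  by rewrite nth_rcons size_code ltnn eqxx.
by rewrite nth_rcons size_code kn IH.
Qed.

Lemma measurable_code n s : measurable [set t | code n t = s].
Proof.
elim: n s => [|n IH] s /=.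
  have [->|s0] := eqVneq s [::].
    by rewrite (_ : [set _ | _] = setT)//; apply/seteqP; split.
  rewrite (_ : [set _ | _] = set0)//; apply/seteqP; split=> //= t /esym/eqP.
  by rewrite (negbTE s0).
case/lastP: s => [|s b].
  rewrite (_ : [set _ | _] = set0)//; apply/seteqP; split=> //= t.
  by move=> /(congr1 size); rewrite size_rcons.
rewrite (_ : [set _ | _] = [set t | code n t = s] `&` [set t | (cut s <= t) = b]).
  apply: measurableI; first exact: IH.
  case: b.
    rewrite (_ : [set _ | _] = `[cut s, +oo[%classic); first exact: measurable_itv.
    by apply/seteqP; split=> t /=; rewrite in_itv/= andbT.
  rewrite (_ : [set _ | _] = `]-oo, cut s[%classic); first exact: measurable_itv.
  by apply/seteqP; split=> t /=; rewrite in_itv/= ltNge; [move=> ->|move/negbTE].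
apply/seteqP; split=> t /=; first by move=> /rcons_inj[-> <-].
by move=> [-> ->].
Qed.

Lemma measurable_code_bit k : measurable [set t | cut (code k t) <= t].
Proof.
rewrite (_ : [set _ | _] =
    \big[setU/set0]_(s : k.-tuple bool) [set t | code k.+1 t = rcons s true]).
  by apply: bigsetU_measurable => s _; exact: measurable_code.
apply/seteqP; split=> t /=; rewrite -bigcup_seq.
  move=> ct; exists (Tuple (introT eqP (size_code k t))) => /=.
    by rewrite mem_index_enum.
  by rewrite ct.
by move=> [s _] /= /rcons_inj[_ ->].
Qed.

Lemma lebesgue_code s :
  lebesgue_measure ([set t | code (size s) t = s] `&` `[(0 : R), 1[) = (m s)%:E.
Proof.
rewrite (_ : _ `&` _ = `[left_end s, left_end s + m s[%classic); last first.
  apply/seteqP; split=> t /=; rewrite !in_itv/=.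
    by move=> [h1 h2]; apply/code_itv.
  by move=> /code_itv[].
rewrite lebesgue_measure_itv/= lte_fin ltrDl; have [_|m0] := ltP 0 (m s).
  by rewrite -EFinB addrAC subrr add0r.
by congr EFin; apply/eqP; rewrite eq_le m_ge0 m0.
Qed.

End nested_intervals.

(** * A measure with prescribed cylinder expectations *)

Section extension.
Context {R : realType} {d : nat}.
Implicit Types (U V : {fset site d}) (f g : config d -> R).

(** Numbers that code no site read as [false], so that words of every length are defined. *)
Definition enum_spin (x : config d) (k : nat) : bool :=
  if pickle_inv k is Some v then x v else false.

Definition prefix_of n (x : config d) : seq bool := mkseq (enum_spin x) n.

(** Not a geometric cube but the sites with code below [n]: an increasing sequence that eventually
    contains every finite set of sites. *)
Definition box n : {fset site d} := [fset v in pmap (@pickle_inv (site d)) (iota 0 n)]%fset.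

Lemma in_box n v : (v \in box n) = (choice.pickle v < n)%N.
Proof.
rewrite /box !inE/= mem_pmap; apply/mapP/idP => [[k]|vn].
  rewrite mem_iota add0n/= => kn /esym vk.
  by have := @pickle_invK (site d) k; rewrite /oapp vk => ->.
by exists (choice.pickle v); rewrite ?mem_iota ?pickleK_inv.
Qed.

Lemma box_mono m n : (m <= n)%N -> (box m `<=` box n)%fset.
Proof. by move=> mn; apply/fsubsetP => v; rewrite !in_box => /leq_trans; exact. Qed.

Lemma sub_box U : exists n, (U `<=` box n)%fset.
Proof.
exists (\max_(v <- U) choice.pickle v).+1; apply/fsubsetP => v vU.
by rewrite in_box ltnS; exact: leq_bigmax_seq.
Qed.

Lemma cylinder_prefix n s : cylinder (fun x : config d => (prefix_of n x == s)%:R : R).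
Proof.
exists (box n) => x z xz; congr ((_ == _)%:R); apply/eq_in_map => k.
rewrite mem_iota add0n/= => kn; rewrite /enum_spin.
case vk : (pickle_inv k) => [v|//]; apply: xz; rewrite /= in_box.
by have := @pickle_invK (site d) k; rewrite /oapp vk => ->.
Qed.

Variable ell : (config d -> R) -> R.
Hypotheses (ellD : forall f g, cylinder f -> cylinder g ->
    ell (fun z => f z + g z) = ell f + ell g)
  (ellZ : forall (c : R) f, cylinder f -> ell (fun z => c * f z) = c * ell f)
  (ell_ge0 : forall f, cylinder f -> (forall z, 0 <= f z) -> 0 <= ell f)
  (ell1 : ell (fun=> 1) = 1).

Lemma ell_sum (I : Type) (r : seq I) (F : I -> config d -> R) :
  (forall i, cylinder (F i)) ->
  ell (fun z => \sum_(i <- r) F i z) = \sum_(i <- r) ell (F i).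
Proof.
move=> FC; elim: r => [|i r IH].
  rewrite big_nil (_ : (fun z => _) = fun z => 0 * 1); last first.
    by apply/funext => z; rewrite big_nil mul0r.
  by rewrite ellZ ?mul0r//; exact: cylinder_cst.
under eq_fun do rewrite big_cons.
by rewrite ellD// ?IH ?big_cons//; exact: cylinder_sum_fun.
Qed.

Let m (s : seq bool) : R := ell (fun x => (prefix_of (size s) x == s)%:R).

Let m1 : m [::] = 1.
Proof. by rewrite /m -[RHS]ell1; congr ell; apply/funext => x. Qed.

Let m_ge0 s : 0 <= m s.
Proof. by apply: ell_ge0 => [|z]; [exact: cylinder_prefix|]. Qed.

Let mE s : m s = m (rcons s false) + m (rcons s true).
Proof.
rewrite /m -ellD; [|exact: cylinder_prefix|exact: cylinder_prefix].
congr ell; apply/funext => x; rewrite !size_rcons /prefix_of !mkseqS !eqseq_rcons.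
by case: (_ == s) => //=; case: (enum_spin _ _); rewrite ?addr0 ?add0r.
Qed.

Let phi (t : R) : config d := fun v => cut m (code m (choice.pickle v) t) <= t.

Let mphi : measurable_fun [set: R] phi.
Proof.
by apply: measurable_to_config => v; exact: measurable_code_bit.
Qed.

(** The measure is the law of [phi] under the uniform distribution on [0, 1[, where [phi] reads the
    spin at a site off the bit whose position is the code of that site. A pattern on [U] is a finite
    disjoint union of words, whose intervals have the lengths prescribed by [ell]. *)
Lemma probability_of_functional : exists mu : probability (config d) R,
  forall f, cylinder f -> \int[mu]_x f x = ell f.
Proof.
pose nu : {measure set (measurableTypeR R) -> \bar R} :=
  mrestr lebesgue_measure (measurable_itv `[(0 : R), 1[).
have nuT : nu setT = 1%E.
  by rewrite /= /mrestr setTI lebesgue_measure_itv/= lte_fin ltr01 oppr0 adde0.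
pose unif : probability (measurableTypeR R) R :=
  HB.pack (nu : set (measurableTypeR R) -> \bar R) (Measure.on nu)
    (Measure_isProbability.Build _ _ _ nu nuT).
have mphi' : measurable_fun [set: measurableTypeR R] (phi : measurableTypeR R -> config d).
  exact: mphi.
pose phi_mfun : {mfun measurableTypeR R >-> config d} :=
  HB.pack (phi : measurableTypeR R -> config d) (isMeasurableFun.Build _ _ _ _ _ mphi').
pose mu : probability (config d) R := distribution unif phi_mfun.
exists mu => f [U fU].
suff muU (s : {ffun U -> bool}) : mu [set x | spins_on U x = s] = (ell (pattern s))%:E.
  rewrite (cylinder_sum (@top _) fU) mean_sum; last first.
    move=> s; apply: bounded_mfunZ; apply: cylinder_bounded_mfun; exact: cylinder_pattern.
  rewrite ell_sum; last by move=> s; apply: cylinderZ; exact: cylinder_pattern.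
  apply: eq_bigr => s _; rewrite ellZ; last exact: cylinder_pattern.
  rewrite RintegralZl//; last first.
    exact/bounded_mfun_integrable/cylinder_bounded_mfun/cylinder_pattern.
  congr (_ * _); apply: EFin_inj; rewrite -muU pattern_indic mean_indic//.
  exact: measurable_spins_on.
have [n Un] := sub_box U.
(* The words of length [n] that spell [s] at the codes of the sites of [U]; both sides equal the sum
   of their masses. *)
pose good (w : n.-tuple bool) := [forall v : U, nth false w (choice.pickle (val v)) == s v].
have sum_good (w : n.-tuple bool) :
    \sum_(w' : n.-tuple bool) (good w')%:R * (w == w')%:R = (good w)%:R :> R.
  rewrite (bigD1 w)//= eqxx mulr1 big1 ?addr0// => w'.
  by rewrite eq_sym => /negbTE ->; rewrite mulr0.
have pickle_lt (v : U) : (choice.pickle (val v) < n)%N.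
  by rewrite -in_box; exact/(fsubsetP Un)/valP.
have patternE (x : config d) : pattern s x =
    \sum_(w : n.-tuple bool) (good w)%:R * (prefix_of (size w) x == w)%:R :> R.
  rewrite /pattern.
  have szx : size (prefix_of n x) == n by rewrite size_mkseq.
  under eq_bigr => w _ do rewrite size_tuple -[prefix_of n x]/(val (Tuple szx)) val_eqE.
  rewrite sum_good; congr (nat_of_bool _)%:R; apply/eqP/forallP => [<- v|h].
    by rewrite nth_mkseq ?pickle_lt// /enum_spin pickleK_inv ffunE.
  apply/ffunP => v; rewrite ffunE -(eqP (h v)) nth_mkseq ?pickle_lt//.
  by rewrite /enum_spin pickleK_inv.
rewrite [in RHS](funext patternE) ell_sum; last first.
  by move=> w; apply: cylinderZ; exact: cylinder_prefix.
rewrite (eq_bigr (fun w : n.-tuple bool => (good w)%:R * m w)); last first.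
  by move=> w _; rewrite ellZ//; exact: cylinder_prefix.
transitivity (unif [set t | spins_on U (phi t) = s]); first by [].
have mset : measurable ([set t | spins_on U (phi t) = s] : set (measurableTypeR R)).
  by rewrite -[X in measurable X]setTI; exact: (mphi measurableT (measurable_spins_on s)).
rewrite -mean_indic//.
transitivity (\int[unif]_t
   (\sum_(w : n.-tuple bool) (good w)%:R * \1_[set t | code m n t = w] t))%:E.
  congr EFin; apply: eq_Rintegral => t _.
  have szt : size (code m n t) == n by rewrite size_code.
  rewrite (eq_bigr (fun w => (good w)%:R * (Tuple szt == w)%:R)); last first.
    move=> w _; rewrite indicE -val_eqE/=; congr (_ * (nat_of_bool _)%:R).
    by apply/idP/eqP; rewrite inE.
  rewrite sum_good indicE; congr (nat_of_bool _)%:R; apply/idP/forallP; rewrite inE/=.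
    move=> <- v; rewrite nth_code ?pickle_lt// ffunE; exact/eqP.
  by move=> h; apply/ffunP => v; rewrite ffunE -(eqP (h v)) nth_code// pickle_lt.
rewrite mean_sum; last first.
  by move=> w; apply/bounded_mfunZ/bounded_mfun_indic; exact: measurable_code.
congr EFin; apply: eq_bigr => w _.
rewrite RintegralZl//; last first.
  apply: bounded_mfun_integrable; apply: bounded_mfun_indic; exact: measurable_code.
congr (_ * _); apply: EFin_inj; rewrite mean_indic; last exact: measurable_code.
have := @lebesgue_code _ m m1 m_ge0 mE w.
by rewrite size_tuple.
Qed.

End extension.

(** * Conditional probabilities and the DLR equations *)

Section conditional_mean.
Context {dT : measure_display} {T : measurableType dT} {R : realType}.
Variable P : probability T R.
Implicit Types (f g k Z : T -> R) (C : set T) (G : set (set T)).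

Notation integrable f := (P.-integrable [set: T] (EFin \o f)).

Lemma integrable_lin (a b : R) f g : integrable f -> integrable g ->
  integrable (fun w => a * f w + b * g w).
Proof.
move=> fi gi; have := integrableD measurableT (integrableZl measurableT a fi)
  (integrableZl measurableT b gi).
by apply: eq_integrable => // w _.
Qed.

Lemma integrable_sub f g : integrable f -> integrable g ->
  integrable (fun w => f w - g w).
Proof.
by move=> fi gi; have := integrableB measurableT fi gi; apply: eq_integrable.
Qed.

Lemma integrable_dist f g : integrable f -> integrable g ->
  integrable (fun w => `|f w - g w|).
Proof.
move=> fi gi; have := integrable_norm (integrable_sub fi gi).
by apply: eq_integrable.
Qed.

Lemma mean_lin (a b : R) f g : integrable f -> integrable g ->
  \int[P]_w (a * f w + b * g w) = a * \int[P]_w f w + b * \int[P]_w g w.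
Proof.
move=> fi gi; rewrite RintegralD//; last 2 first.
- by have := integrableZl measurableT a fi; apply: eq_integrable.
- by have := integrableZl measurableT b gi; apply: eq_integrable.
by rewrite !RintegralZl.
Qed.

(** Conditional expectation contracts the L1 distance to a [G]-measurable [Z]. The sign of [f - Z]
    is [2 * \1_C - 1] with [C] in [G]; integrated against this sign, [f] may be replaced by [k], and
    the result is at most the mean of |k - Z|. *)
Lemma mean_normB_le G f k Z : sigma_algebra setT G -> G `<=` measurable ->
  (forall D : set R, measurable D -> G (f @^-1` D)) ->
  (forall D : set R, measurable D -> G (Z @^-1` D)) ->
  integrable f -> integrable k -> integrable Z ->
  (forall C, G C -> \int[P]_(w in C) (f w)%:E = \int[P]_(w in C) (k w)%:E)%E ->
  \int[P]_w `|f w - Z w| <= \int[P]_w `|k w - Z w|.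
Proof.
move=> sG Gm Gf GZ fi ki Zi fk; have GE : <<s G >> = G by exact: sigma_algebra_id.
have mG h : (forall D : set R, measurable D -> G (h @^-1` D)) ->
    measurable_fun [set: g_sigma_algebraType G] (h : g_sigma_algebraType G -> R).
  by move=> Gh _ D mD; rewrite setTI /measurable/= GE; exact: Gh.
pose C := [set w | Z w <= f w].
have GC : G C.
  have := measurable_fun_ler (mG _ GZ) (mG _ Gf).
  move=> /(_ measurableT [set true] Logic.I); rewrite setTI /measurable/= GE.
  by congr G; apply/seteqP; split.
have mC : measurable C by exact: Gm.
have GT : G setT by rewrite -GE; exact: (@measurableT _ (g_sigma_algebraType G)).
have MK h : integrable h -> integrable (fun w => 2 * (\1_C w * h w) + -1 * h w).
  by move=> hi; apply: integrable_lin => //; exact: integrable_indicM.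
have M h : integrable h ->
    \int[P]_w (2 * (\1_C w * h w) + -1 * h w) =
    2 * fine (\int[P]_(w in C) (h w)%:E)%E - fine (\int[P]_w (h w)%:E)%E.
  move=> hi; rewrite mean_lin//; last exact: integrable_indicM.
  by rewrite mulN1r integral_EFin_indic.
have sub h : integrable h -> \int[P]_w ((2 * (\1_C w * h w) + -1 * h w) -
      (2 * (\1_C w * Z w) + -1 * Z w)) =
    \int[P]_w (2 * (\1_C w * h w) + -1 * h w) - \int[P]_w (2 * (\1_C w * Z w) + -1 * Z w).
  by move=> hi; rewrite RintegralB//; exact: MK.
rewrite (_ : \int[P]_w `|f w - Z w| = \int[P]_w ((2 * (\1_C w * f w) + -1 * f w) -
      (2 * (\1_C w * Z w) + -1 * Z w))); last first.
  apply: eq_Rintegral => w _; rewrite indicE; have [wC|wC] := boolP (w \in C).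
    by move: wC; rewrite inE /C/= => Zf; rewrite ger0_norm ?subr_ge0//=; lra.
  move: wC; rewrite notin_setE /C/= => /negP; rewrite -ltNge => fZ.
  by rewrite ltr0_norm ?subr_lt0//=; lra.
rewrite sub// M// !fk// -M// -sub//; apply: le_Rintegral => //.
- by apply: integrable_sub; exact: MK.
- exact: integrable_dist.
move=> w _; have := ler_norm (k w - Z w); have := ler_norm (- (k w - Z w)); rewrite normrN.
by rewrite indicE; case: (w \in C) => /=; lra.
Qed.

(** The contraction above, with [k] also in the role of [Z]: the right-hand side is then 0. *)
Lemma is_cond_prob_ae_eq G B f k : sigma_algebra setT G -> G `<=` measurable ->
  is_cond_prob P G B f -> is_cond_prob P G B k -> {ae P, forall w, f w = k w}.
Proof.
move=> sG Gm [Gf fi fB] [Gk ki kB].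
have : \int[P]_w `|f w - k w| <= \int[P]_w `|k w - k w|.
  by apply: (mean_normB_le sG) => // C GC; rewrite fB// kB.
under [leRHS]eq_Rintegral do rewrite subrr normr0.
rewrite mean_cst => fk.
have di : integrable (fun w => f w - k w).
  exact: integrable_sub.
have : (\int[P]_w `|(EFin \o (fun w => (f w - k w)%R)) w| = 0)%E.
  apply/eqP; rewrite eq_le integral_ge0 ?andbT => [|w _]; last exact: abse_ge0.
  have -> : (\int[P]_w `|(EFin \o (fun w => (f w - k w)%R)) w| =
      (\int[P]_w `|f w - k w|)%R%:E)%E.
    by rewrite EFin_mean//; exact: integrable_dist.
  by rewrite lee_fin.
move/(ae_eq_integral_abs P measurableT (measurable_int _ di)).
by apply: filterS => w /(_ Logic.I) [] /eqP; rewrite subr_eq0 => /eqP.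
Qed.

End conditional_mean.

Lemma indic_preimage {R : pzRingType} {T T' : Type} (F : T -> T') (A : set T') w :
  \1_(F @^-1` A) w = \1_A (F w) :> R.
Proof. by rewrite !indicE; congr (nat_of_bool _)%:R; apply/idP/idP; rewrite !inE. Qed.

Section spin_systems.
Context {R : realType} {d : nat}.
Variables (L : {fset site d} -> (config d -> R) -> config d -> R)
  (N : {fset site d} -> {fset site d}) (kappa : kernel_family R d).
Hypotheses (LN : spec_op L N)
  (kappaE : forall V x A, measurable A -> kappa V x A = (L V \1_A x)%:E).

Lemma coordinate_fields_glue (T : pointedType) (Z : T -> config d) (V : {fset site d})
    (s : {ffun V -> bool}) (A : set (config d)) : measurable A ->
  <<s coordinate_fields Z (complement V) >> [set w | A (glue (Z w) s)].
Proof.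
move=> mA; pose TZ := g_sigma_algebraType (coordinate_fields Z (complement V)).
have mg : measurable_fun [set: TZ] (fun w : TZ => glue (Z w) s : config d).
  apply: measurable_to_config => v; have [vV|vV] := boolP (v \in V).
    rewrite (_ : [set w | _] = if s [`vV]%fset then setT else set0).
      by case: ifP.
    apply/seteqP; split=> w /=; rewrite -[v in glue _ _ v]/(val [`vV]%fset) glue_in.
      by move=> ->.
    by case: ifP.
  rewrite (_ : [set w | _] = [set w | Z w v = true]).
    exact: (@coordinate_fields_spin _ _ Z (complement V)).
  by apply/seteqP; split=> w /=; rewrite glue_out.
by have := mg measurableT A mA; rewrite setTI.
Qed.

Lemma measurable_glue (V : {fset site d}) (s : {ffun V -> bool}) :
  measurable_fun [set: config d] (fun x : config d => glue x s : config d).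
Proof.
move=> _ A mA; rewrite setTI.
apply: (@measurable_coordinate_fields _ _ _ (fun x : config d => x) (complement V)).
  by move=> v; exact: (measurable_spin v true).
exact: (@coordinate_fields_glue (config d) id).
Qed.

Lemma op_cylinder V f : cylinder f -> cylinder (L V f).
Proof.
move=> [U fU]; exists (U `|` N V)%fset.
apply: depends_onW (op_depends LN fU) => v [+ _] /=.
by rewrite in_fsetU => -[] ->; rewrite ?orbT.
Qed.

Lemma op_bounded_mfun V f : bounded_mfun f -> bounded_mfun (L V f).
Proof.
move=> [mf [M fM]]; rewrite (_ : L V f = fun x =>
    \sum_(s : {ffun V -> bool}) L V (pattern s) x * f (glue x s)).
  apply: bounded_mfun_sum => s; apply: bounded_mfunM.
    exact/cylinder_bounded_mfun/op_cylinder/cylinder_pattern.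
  split; last by exists M.
  exact: (measurableT_comp mf (measurable_glue s)).
by apply/funext => x; exact: (op_pattern LN).
Qed.

Section random_field.
Context {dO : measure_display} {Omega : measurableType dO}.
Variables (P : probability Omega R) (X : {mfun Omega >-> config d}).

Lemma bounded_mfun_comp (f : config d -> R) : bounded_mfun f -> bounded_mfun (fun w => f (X w)).
Proof.
by move=> [mf [M fM]]; split; [exact: measurableT_comp|exists M].
Qed.

Lemma measurable_coordinate v : measurable [set w | X w v].
Proof.
have := measurable_funP X measurableT _ (measurable_spin v true).
by rewrite setTI.
Qed.

Lemma sigma_field_measurable D : sigma_field X D `<=` measurable.
Proof. exact/measurable_coordinate_fields/measurable_coordinate. Qed.

Lemma sigma_field_op V f (D : set R) : bounded_mfun f -> measurable D ->
  sigma_field X (complement V) ((fun w => L V f (X w)) @^-1` D).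
Proof.
move=> bf mD; pose s : {ffun V -> bool} := [ffun=> false].
have mA : measurable (L V f @^-1` D).
  by have [mL _] := op_bounded_mfun V bf; rewrite -[X in measurable X]setTI; exact: mL.
rewrite (_ : _ @^-1` D = [set w | (L V f @^-1` D) (glue (X w) s)]).
  exact: coordinate_fields_glue.
apply/seteqP; split=> w /=; rewrite (@op_off _ _ _ _ LN V f (glue (X w) s) (X w))//.
  by move=> v /= /negP vV; rewrite glue_out.
by move=> v /= /negP vV; rewrite glue_out.
Qed.

(** The Gibbs property as equations between expectations of cylinder functions, a form that is
    stable under limits. The lemmas [specified_dlr] and [dlr_specified] show it equivalent to
    [specified_by]. *)
Definition dlr := forall V f, cylinder f ->
  \int[P]_w f (X w) = \int[P]_w L V f (X w).

Lemma specified_mean V A : specified_by P X kappa -> measurable A ->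
  P (X @^-1` A) = (\int[P]_w L V \1_A (X w))%:E.
Proof.
move=> PX mA.
have mXA : measurable (X @^-1` A) by rewrite -[X in measurable X]setTI; exact: measurable_funP.
have sV := smallest_sigma_algebra setT
  (\bigcup_(v in complement V)
        preimage_set_system [set: Omega] (fun w => X w v) measurable).
have [_ ci cB] := is_cond_prob_cond_prob P sV (@sigma_field_measurable _) mXA.
have bL : bounded_mfun (fun w => L V \1_A (X w)).
  exact/bounded_mfun_comp/op_bounded_mfun/bounded_mfun_indic.
have := cB setT; rewrite setIT => <-; last first.
  exact: (@measurableT _ (g_sigma_algebraType _)).
rewrite EFin_mean; last exact: bounded_mfun_integrable.
apply: ae_eq_integral => //.
- exact: measurable_int ci.
- by case: bL => mL _; exact/measurable_EFinP.
have := PX V A mA; apply: filterS => w + _.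
by rewrite kappaE// => -[->].
Qed.

Lemma specified_dlr : specified_by P X kappa -> dlr.
Proof.
move=> PX V f [U fU]; rewrite (cylinder_sum (@top _) fU).
have E x : L V (fun z => \sum_(s : {ffun U -> bool}) f (glue (@top _) s) * pattern s z) x =
    \sum_(s : {ffun U -> bool}) f (glue (@top _) s) * L V (pattern s) x.
  by rewrite (op_sum LN); apply: eq_bigr => s _; rewrite (opZ LN).
under [RHS]eq_Rintegral do rewrite E.
have bp (s : {ffun U -> bool}) : bounded_mfun (pattern s : config d -> R).
  exact/cylinder_bounded_mfun/cylinder_pattern.
rewrite !mean_sum; last 2 first.
- by move=> s; apply/bounded_mfunZ/bounded_mfun_comp/op_bounded_mfun.
- by move=> s; apply/bounded_mfunZ/bounded_mfun_comp.
apply: eq_bigr => s _; rewrite !RintegralZl//; last 2 first.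
- exact/bounded_mfun_integrable/bounded_mfun_comp/op_bounded_mfun.
- exact/bounded_mfun_integrable/bounded_mfun_comp.
congr (_ * _); apply: EFin_inj; rewrite pattern_indic -specified_mean//; last first.
  exact: measurable_spins_on.
rewrite -mean_indic//.
rewrite -[X in measurable X]setTI; apply: measurable_funP => //.
exact: measurable_spins_on.
Qed.

(** For a pattern on [V], the equations are tested against cylinder events off [V], which come out
    of [L V], and extended to all events off [V] by uniqueness of integrals. For general [A], the
    indicator of [A] at X is a finite sum over patterns [s] of [pattern s] at X times the indicator
    that X with [s] pasted on [V] lies in [A]; the second factor is measurable off [V]. *)
Lemma dlr_specified : dlr -> specified_by P X kappa.
Proof.
move=> PX V A mA; set G := sigma_field X (complement V).
have sG : sigma_algebra setT G by exact: smallest_sigma_algebra.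
have Gm : G `<=` measurable by exact: sigma_field_measurable.
have mXA B : measurable B -> measurable (X @^-1` B).
  by move=> mB; rewrite -[X in measurable X]setTI; exact: measurable_funP.
have Gglue (s : {ffun V -> bool}) : G [set w | A (glue (X w) s)].
  exact: coordinate_fields_glue.
have bL f : bounded_mfun f -> bounded_mfun (fun w => L V f (X w)).
  by move=> bf; exact/bounded_mfun_comp/op_bounded_mfun.
have bp (s : {ffun V -> bool}) : bounded_mfun (pattern s : config d -> R).
  exact/cylinder_bounded_mfun/cylinder_pattern.
have bA : bounded_mfun (\1_A : config d -> R) by exact: bounded_mfun_indic.
have key (s : {ffun V -> bool}) B : G B ->
    (\int[P]_(w in B) (pattern s (X w))%:E = \int[P]_(w in B) (L V (pattern s) (X w))%:E)%E.
  apply: (@integral_coordinate_unique _ _ _ _ P (fun w => X w) (complement V)).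
  - exact: measurable_coordinate.
  - exact/bounded_mfun_integrable/bounded_mfun_comp.
  - exact/bounded_mfun_integrable/bL.
  move=> U UV; have mU := @measurable_up_cylinder _ _ _ (fun w => X w) measurable_coordinate U.
  rewrite !integral_EFin_indic//; last 2 first.
  - exact/bounded_mfun_integrable/bL.
  - exact/bounded_mfun_integrable/bounded_mfun_comp.
  pose c : config d -> R := \1_(up_cylinder (fun x : config d => x) U).
  have cU : depends_on [set` U] c by exact: depends_on_up_cylinder.
  have cX w : \1_(up_cylinder (fun w => X w) U) w = c (X w) by rewrite /c -indic_preimage.
  congr EFin; under eq_Rintegral do rewrite cX; under [RHS]eq_Rintegral do rewrite cX.
  rewrite (PX V (fun z => c z * pattern s z)); last first.
    by apply: cylinderM; [exists U|exact: cylinder_pattern].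
  apply: eq_Rintegral => w _; rewrite (opM LN)//.
  by apply: (depends_onW _ cU) => v /UV /= /negP.
suff K : is_cond_prob P G (X @^-1` A) (fun w => L V \1_A (X w)).
  have := is_cond_prob_ae_eq sG Gm (is_cond_prob_cond_prob P sG Gm (mXA _ mA)) K.
  by apply: filterS => w ->; rewrite kappaE.
split.
- by move=> D mD; exact: sigma_field_op.
- exact/bounded_mfun_integrable/bL.
move=> C GC; have mC := Gm _ GC.
transitivity (\int[P]_w (\1_C w * \1_A (X w)))%:E; last first.
  rewrite -mean_indic; last by apply: measurableI => //; exact: mXA.
  congr EFin; apply: eq_Rintegral => w _.
  by rewrite indicI /= mulrC indic_preimage.
rewrite integral_EFin_indic//; last exact/bounded_mfun_integrable/bL.
congr EFin.
have term (f : config d -> R) w (s : {ffun V -> bool}) :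
    \1_C w * (f (X w) * \1_A (glue (X w) s)) =
    \1_(C `&` [set w | A (glue (X w) s)]) w * f (X w).
  by rewrite indicI /= -mulrA [_ * f _]mulrC; congr (_ * (_ * _)).
transitivity (\int[P]_w \sum_(s : {ffun V -> bool})
    \1_(C `&` [set w | A (glue (X w) s)]) w * L V (pattern s) (X w)).
  apply: eq_Rintegral => w _; rewrite (op_pattern LN) mulr_sumr.
  by apply: eq_bigr => s _; exact: term.
transitivity (\int[P]_w \sum_(s : {ffun V -> bool})
    \1_(C `&` [set w | A (glue (X w) s)]) w * pattern s (X w)); last first.
  apply: eq_Rintegral => w _.
  rewrite -[X in \1_A X](@spins_onK _ V (X w) (X w))//.
  rewrite -(@sum_pattern _ _ V (fun s => \1_A (glue (X w) s)) (X w)) mulr_sumr.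
  by apply: eq_bigr => s _; rewrite -term [pattern _ _ * _]mulrC.
have mCg (s : {ffun V -> bool}) : G (C `&` [set w | A (glue (X w) s)]).
  pose TX := g_sigma_algebraType (coordinate_fields (fun w => X w) (complement V)).
  exact: (@measurableI _ TX _ _ GC (Gglue s)).
rewrite !mean_sum; last 2 first.
- by move=> s; apply: bounded_mfunM; [exact/bounded_mfun_indic/Gm|exact: bounded_mfun_comp].
- by move=> s; apply: bounded_mfunM; [exact/bounded_mfun_indic/Gm|exact: bL].
apply: eq_bigr => s _; apply: EFin_inj.
rewrite -!integral_EFin_indic//; try exact: Gm.
- by rewrite key.
- exact/bounded_mfun_integrable/bounded_mfun_comp.
- exact/bounded_mfun_integrable/bL.
Qed.

End random_field.

End spin_systems.

(** * Uniqueness and the gap between extreme boundary conditions *)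

Section thermodynamic_limit.
Context {R : realType} {d : nat}.
Variables (L : {fset site d} -> (config d -> R) -> config d -> R)
  (N : {fset site d} -> {fset site d}) (kappa : kernel_family R d).
Hypotheses (LN : spec_op L N) (Lmono : dominated L L)
  (kappaE : forall V x A, measurable A -> kappa V x A = (L V \1_A x)%:E).

Lemma cylinder_increasing_diff (f : config d -> R) : cylinder f ->
  exists g h : config d -> R, [/\ cylinder g, cylinder h, increasing g, increasing h
    & f = fun z => g z - h z].
Proof.
move=> fC; have [U fU] := fC; have [_ [M fM]] := cylinder_bounded_mfun fC.
have M0 : 0 <= M by exact: le_trans (fM (@top _)).
(* The oscillation of [f] is at most 2M; the extra 1 keeps [c] positive when [M] is 0. *)
pose c := 2 * M + 1; have c0 : 0 < c by rewrite /c; lra.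
pose f' z := c^-1 * f z.
have f'U : depends_on [set` U] f' by move=> x z /fU; rewrite /f' => ->.
have f'1 x z : f' x - f' z <= 1.
  rewrite /f' -mulrBr mulrC ler_pdivrMr// mul1r /c.
  by have := fM x; have := fM z; rewrite !ler_norml => /andP[? ?] /andP[? ?]; lra.
exists (fun z => c * (f' z + count_on U z)), (fun z => c * count_on U z).
have cU : cylinder (count_on U : config d -> R) by exists U; exact: depends_on_count_on.
split.
- by apply/cylinderZ/cylinderD => //; exists U.
- exact: cylinderZ.
- by move=> x z xz; rewrite ler_pM2l//; exact: (increasing_add_count_on f'U f'1).
- by move=> x z xz; rewrite ler_pM2l//; exact: increasing_count_on.
- by apply/funext => z; rewrite mulrDr addrK /f' mulVKf// gt_eqF.
Qed.

Lemma op_norm_le V (f : config d -> R) M x : (forall z, `|f z| <= M) -> `|L V f x| <= M.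
Proof.
move=> fM; rewrite ler_norml; apply/andP; split.
  rewrite -[leLHS](op_cst LN V _ x); apply: (op_le LN) => z.
  by have := fM z; rewrite ler_norml => /andP[].
rewrite -[leRHS](op_cst LN V _ x); apply: (op_le LN) => z.
by have := fM z; rewrite ler_norml => /andP[].
Qed.

Definition limits_at b := forall f : config d -> R, cylinder f ->
  cvgn (fun n => L (box n) f b).

Lemma limits_at_increasing b :
  (forall f : config d -> R, cylinder f -> increasing f -> cvgn (fun n => L (box n) f b)) ->
  limits_at b.
Proof.
move=> H f /cylinder_increasing_diff[g [h [gC hC ginc hinc ->]]].
under eq_fun do rewrite (opB LN).
by apply: is_cvgB; exact: H.
Qed.

Lemma limits_at_top : limits_at (@top _).
Proof.
apply: limits_at_increasing => f fC finc; apply: nonincreasing_is_cvgn.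
  by move=> m n mn; apply: (op_top_antitone LN) => //; exact: box_mono.
have [_ [M fM]] := cylinder_bounded_mfun fC.
exists (- M) => _ [n _ <-].
by have := op_norm_le (box n) (@top _) fM; rewrite ler_norml => /andP[].
Qed.

Lemma limits_at_bottom : limits_at (@bottom _).
Proof.
apply: limits_at_increasing => f fC finc; apply: nondecreasing_is_cvgn.
  by move=> m n mn; apply: (op_bottom_monotone LN) => //; exact: box_mono.
have [_ [M fM]] := cylinder_bounded_mfun fC.
exists M => _ [n _ <-].
by have := op_norm_le (box n) (@bottom _) fM; rewrite ler_norml => /andP[].
Qed.

(** Since [L V f] is again a cylinder function, its expectations converge too, and they equal those
    of [f] as soon as [box n] contains [V]. The limit measure thus satisfies the DLR equations; the
    field is the identity on configurations. *)
Lemma gibbs_limit b : limits_at b -> exists2 mu : probability (config d) R,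
  gibbs kappa mu & forall f, cylinder f -> L (box n) f b @[n --> \oo] --> \int[mu]_x f x.
Proof.
move=> Lb; pose ell (f : config d -> R) := limn (fun n => L (box n) f b).
have ellZ (c : R) f : cylinder f -> ell (fun z => c * f z) = c * ell f.
  move=> fC; rewrite /ell; under eq_fun do rewrite (opZ LN).
  by apply: (@cvg_lim R) => //; apply: cvgMl_tmp; exact: Lb.
have ell_ge0 f : cylinder f -> (forall z, 0 <= f z) -> 0 <= ell f.
  move=> fC f0; apply: limr_ge; first exact: Lb.
  by apply: nearW => n; exact: (op_ge0 LN).
have ell1 : ell (fun=> 1) = 1.
  by rewrite /ell; under eq_fun do rewrite (op1 LN); exact: lim_cst.
have ellD f g : cylinder f -> cylinder g -> ell (fun z => f z + g z) = ell f + ell g.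
  move=> fC gC; rewrite /ell; under eq_fun do rewrite (opD LN).
  by apply: (@cvg_lim R) => //; apply: cvgD; exact: Lb.
have [mu muE] := probability_of_functional ellD ellZ ell_ge0 ell1.
have muC f : cylinder f -> L (box n) f b @[n --> \oo] --> \int[mu]_x f x.
  by move=> fC; rewrite muE//; exact: Lb.
exists mu => //.
pose X : {mfun config d >-> config d} :=
  HB.pack (idfun : config d -> config d)
    (isMeasurableFun.Build _ _ _ _ _ (@measurable_id _ (config d) setT)).
exists _, (config d), mu, X; split; last by [].
apply: (dlr_specified LN kappaE) => V f fC.
have VC : cylinder (L V f) by exact: (op_cylinder LN).
apply: (@cvg_unique _ (@Rhausdorff R) _ _ _ _ (muC _ fC)).
apply: cvg_trans (muC _ VC); apply: near_eq_cvg.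
have [n0 Vn] := sub_box V.
exists n0 => // n /= n0n; rewrite (opK LN)//.
exact: fsubset_trans Vn (box_mono n0n).
Qed.

(** Existence is the limit from [top]. Under any Gibbs law, the mean of a cylinder indicator is the
    mean of its image under [L (box n)], within a finite sum of gaps of the value at [top]; hence
    all Gibbs laws agree with that limit on a generating pi-system. *)
Lemma gap_vanishes_gibbs_unique :
  (forall v, gap L (box n) v @[n --> \oo] --> 0) -> gibbs_unique kappa.
Proof.
move=> gap0; have [mu gmu muC] := gibbs_limit limits_at_top.
exists mu => // nu [dT [T [P [X [PX nuX]]]]].
have XE := specified_dlr LN kappaE PX.
have G_mu U : nu (up_cylinder (fun x : config d => x) U) =
    mu (up_cylinder (fun x : config d => x) U).
  set C := up_cylinder _ U.
  have mC : measurable C.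
    by apply: measurable_up_cylinder => v; exact: (measurable_spin v true).
  have CU : depends_on [set` U] (\1_C : config d -> R) by exact: depends_on_up_cylinder.
  have Cc : cylinder (\1_C : config d -> R) by exists U.
  have C1 x z : \1_C x - \1_C z <= 1 :> R.
    by rewrite !indicE; case: (_ \in _); case: (_ \in _); rewrite /=; lra.
  rewrite nuX//; transitivity (\int[mu]_x \1_C x)%:E; last exact: mean_indic.
  transitivity (\int[P]_w \1_(X @^-1` C) w)%:E.
    apply/esym/mean_indic.
    by rewrite -[X in measurable X]setTI; exact: measurable_funP.
  congr EFin; under eq_Rintegral do rewrite indic_preimage.
  apply: (@cvg_unique _ (@Rhausdorff R) (L (box n) (\1_C) (@top _) @[n --> \oo])).
    apply/cvgrPdist_le => e e0.
    have : (\sum_(v <- U) gap L (box n) v) @[n --> \oo] --> \sum_(v <- U) (0 : R).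
      by apply: cvg_big => [|v _]; [exact: add_continuous|exact: gap0].
    rewrite big1// => /cvgrPdist_le/(_ _ e0); apply: filterS => n.
    rewrite sub0r normrN => gn.
    apply: (le_trans _ (le_trans (ler_norm _) gn)).
    rewrite (XE (box n) _ Cc) -[X in _ - X](mean_cst P).
    have bL : bounded_mfun (fun w => L (box n) \1_C (X w)).
      exact/bounded_mfun_comp/(op_bounded_mfun LN)/bounded_mfun_indic.
    have bB : bounded_mfun (fun w => L (box n) \1_C (X w) - L (box n) \1_C (@top _)).
      by apply: bounded_mfunB => //; exact: bounded_mfun_cst.
    rewrite -RintegralB//; last 2 first.
    - exact: bounded_mfun_integrable.
    - exact/bounded_mfun_integrable/bounded_mfun_cst.
    apply: (le_trans (le_normr_Rintegral _ _)) => //; first exact: bounded_mfun_integrable.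
    rewrite -[leRHS](mean_cst P); apply: le_Rintegral => //.
    - exact/integrable_norm/bounded_mfun_integrable.
    - exact/bounded_mfun_integrable/bounded_mfun_cst.
    by move=> w _; exact: (op_top_dist LN Lmono).
  exact: muC.
move=> A mA.
apply: (measure_unique (up_cylinders (fun x : config d => x) setT) (fun=> setT)) => //.
- by rewrite -coordinate_fields_generated.
- exact: up_cylinders_setI.
- by move=> _; exists fset0 => //; apply/seteqP; split.
- by apply/seteqP; split=> // x _; exists 0%N.
- by move=> _ [U _ <-]; exact: G_mu.
- by move=> _; rewrite (le_lt_trans (probability_le1 nu measurableT))// ltry.
Qed.

Lemma gibbs_unique_gap_vanishes : gibbs_unique kappa ->
  forall v, gap L (box n) v @[n --> \oo] --> 0.
Proof.
move=> [mu _ mu_unique] v.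
have [mt gmt mtC] := gibbs_limit limits_at_top.
have [mb gmb mbC] := gibbs_limit limits_at_bottom.
have vC : cylinder (fun x : config d => (x v)%:R : R).
  by exists [fset v]%fset => x z xz; rewrite xz//= inE.
have E (m : probability (config d) R) : gibbs kappa m ->
    \int[m]_x ((x v)%:R : R) = fine (mu [set x | x v = true]).
  move=> gm; rewrite -(mu_unique _ gm); last exact: measurable_spin.
  have mv := measurable_spin v true.
  rewrite -[RHS](congr1 fine (mean_indic m mv)) /=.
  apply: eq_Rintegral => x _; rewrite indicE; congr (nat_of_bool _)%:R.
  by apply/idP/idP; rewrite inE.
have := cvgB (mtC _ vC) (mbC _ vC); rewrite (E _ gmt) (E _ gmb) subrr.
exact.
Qed.

End thermodynamic_limit.

(** * Specifications as operators *)

Section kernel_law.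
Context {d d' : measure_display} {T : measurableType d} {T' : measurableType d'}
  {R : realType}.
Variables (k : R.-pker T ~> T') (x : T).

(** Bundles [k x] as a probability, so that the lemmas on means apply to it. *)
Definition kernel_law : set T' -> \bar R := k x.

HB.instance Definition _ := isMeasure.Build _ _ _ kernel_law
  (measure0 (k x)) (measure_ge0 (k x)) (@measure_semi_sigma_additive _ _ _ (k x)).

HB.instance Definition _ := Measure_isProbability.Build _ _ _ kernel_law (prob_kernel x).

End kernel_law.

(** A countable intersection, along the coding of sites. By the second axiom of a specification,
    gamma_V(x, .) is therefore carried by the configurations equal to [x] off [V]. *)
Lemma coordinate_fields_off (d : nat) (V : {fset site d}) (x : config d) :
  <<s coordinate_fields (fun x : config d => x) (complement V) >>
    [set z : config d | forall v, v \notin V -> z v = x v].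
Proof.
pose TV := g_sigma_algebraType (coordinate_fields (fun x : config d => x) (complement V)).
rewrite (_ : [set z | _] = \bigcap_n [set z : config d |
    if pickle_inv n is Some v then v \notin V -> z v = x v else True]); last first.
  apply/seteqP; split=> z /= zx.
    by move=> n _ /=; case: pickle_inv => // v; exact: zx.
  by move=> v vV; have := zx (choice.pickle v) Logic.I; rewrite /= pickleK_inv; apply.
apply: (@bigcapT_measurable _ TV) => n.
case: (pickle_inv n) => [v|]; last first.
  rewrite (_ : [set _ | _] = setT); last by apply/seteqP; split.
  exact: (@measurableT _ TV).
have [vV|vV] := boolP (v \in V).
  rewrite (_ : [set _ | _] = setT); last by apply/seteqP; split.
  exact: (@measurableT _ TV).
rewrite (_ : [set _ | _] = [set z : config d | z v = x v]).
  exact: (@coordinate_fields_spin (config d) _ (fun x : config d => x)).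
by apply/seteqP; split=> z /=; [apply|move=> ->].
Qed.

Section specifications.
Context {R : realType} {d : nat}.
Variable gamma : {fset site d} -> R.-pker (config d) ~> (config d).
Hypothesis gamma_spec : is_specification gamma.

Definition gamma_law V x : probability (config d) R := kernel_law (gamma V) x.

(** The integral under gamma_V(x, .) for bounded measurable [f], written as a finite sum so that it
    is additive for arbitrary functions, as [spec_op] demands. *)
Definition spec_mean (V : {fset site d}) (f : config d -> R) (x : config d) : R :=
  \sum_(s : {ffun V -> bool}) fine (gamma V x [set z | spins_on V z = s]) * f (glue x s).

Lemma measurable_off (V : {fset site d}) (x : config d) :
  measurable [set z : config d | forall v, v \notin V -> z v = x v].
Proof.
apply: (@measurable_coordinate_fields _ _ _ (fun x : config d => x) (complement V)).
  by move=> v; exact: (measurable_spin v true).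
exact: coordinate_fields_off.
Qed.

Lemma specification_off V x : gamma V x [set z | forall v, v \notin V -> z v = x v] = 1%E.
Proof.
have [_ g2 _] := gamma_spec; rewrite g2; first by rewrite indicE mem_set.
exact: coordinate_fields_off.
Qed.

Lemma mean_gamma V x f : bounded_mfun f -> \int[gamma V x]_z f z = spec_mean V f x.
Proof.
move=> bf; pose Q := gamma_law V x.
transitivity (\int[Q]_z \sum_(s : {ffun V -> bool}) f (glue x s) * pattern s z).
  congr fine; apply: ae_eq_integral => //.
  - by case: bf => mf _; exact/measurable_EFinP.
  - have [mf _] : bounded_mfun (fun z : config d =>
        \sum_(s : {ffun V -> bool}) f (glue x s) * pattern s z).
      by apply: bounded_mfun_sum => s; exact/bounded_mfunZ/cylinder_bounded_mfun/cylinder_pattern.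
    exact/measurable_EFinP.
  exists (~` [set z | forall v, v \notin V -> z v = x v]); split.
  - by apply: measurableC; exact: measurable_off.
  - have := probability_setC Q (measurable_off V x).
    by rewrite [X in (1 - X)%E](specification_off V x) subee.
  move=> z /=; apply: contra_not => zx _; congr EFin.
  by rewrite (@sum_pattern _ _ V (fun s => f (glue x s))) spins_onK.
rewrite mean_sum; last first.
  by move=> s; exact/bounded_mfunZ/cylinder_bounded_mfun/cylinder_pattern.
apply: eq_bigr => s _; rewrite RintegralZl//; last first.
  exact/bounded_mfun_integrable/cylinder_bounded_mfun/cylinder_pattern.
rewrite mulrC pattern_indic; congr (_ * _).
exact: (congr1 fine (mean_indic Q (measurable_spins_on s))).
Qed.

Lemma gammaE V x A : measurable A -> gamma V x A = (spec_mean V \1_A x)%:E.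
Proof.
move=> mA; rewrite -mean_gamma; last exact: bounded_mfun_indic.
by rewrite -[LHS](mean_indic (gamma_law V x)).
Qed.

(** The sup-norm ball of radius 1 around [V]: larger than the boundary, diagonal steps included, but
    a finite set by construction. The digits 0, 1, 2 stand for steps -1, 0, 1. *)
Definition neighbourhood (V : {fset site d}) : {fset site d} :=
  [fset w in allpairs (fun (v : site d) (e : {ffun 'I_d -> 'I_3}) =>
    (v + \row_i (Posz (e i) - 1))%R) V (enum {: {ffun 'I_d -> 'I_3}})]%fset.

Lemma boundary_neighbourhood V v : boundary V v -> v \in neighbourhood V.
Proof.
move=> [_ [u uV uv]]; rewrite /neighbourhood !inE; apply/allpairsP => /=.
have uv1 i : `|u 0 i - v 0 i| <= 1.
  rewrite -uv (bigD1 i)//= lerDl sumr_ge0// => j _; exact: normr_ge0.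
pose e := [ffun i : 'I_d => inord `|(v 0 i - u 0 i + 1)%R|%N : 'I_3].
exists (u, e); split=> //=; first by rewrite mem_enum.
apply/rowP => i; rewrite !mxE ffunE.
have := uv1 i; rewrite ler_norml; move: (u 0 i) (v 0 i) => a b /andP[h1 h2].
by rewrite inordK; lia.
Qed.

Lemma eq_spec_mean (V : {fset site d}) (f g : config d -> R) x :
  (forall s : {ffun V -> bool}, f (glue x s) = g (glue x s)) ->
  spec_mean V f x = spec_mean V g x.
Proof. by move=> fg; apply: eq_bigr => s _; rewrite fg. Qed.

Lemma spec_meanK (V W : {fset site d}) x A : (W `<=` V)%fset -> measurable A ->
  spec_mean V (spec_mean W \1_A) x = spec_mean V \1_A x.
Proof.
move=> WV mA; have [_ _ g3] := gamma_spec.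
have bW : bounded_mfun (spec_mean W \1_A).
  rewrite (_ : spec_mean W _ = fun y => fine (gamma W y A)); last first.
    by apply/funext => y; rewrite gammaE.
  split; first exact/measurableT_comp/measurable_kernel.
  exists 1 => y; rewrite ger0_norm ?fine_ge0//.
  have : (gamma W y A <= 1)%E by exact: (probability_le1 (gamma_law W y) mA).
  by rewrite gammaE//= lee_fin.
apply: EFin_inj; rewrite -gammaE// -(g3 V W WV)// -mean_gamma//.
rewrite (EFin_mean (P := gamma_law V x)); last exact: bounded_mfun_integrable.
by apply: eq_integral => y _; rewrite gammaE.
Qed.

Lemma spec_op_gamma : spec_op spec_mean neighbourhood.
Proof.
have [g1 _ _] := gamma_spec.
have q_ge0 (V : {fset site d}) (x : config d) (s : {ffun V -> bool}) :
    0 <= fine (gamma V x [set z | spins_on V z = s]).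
  exact: fine_ge0.
split.
- by move=> V f k x; rewrite -big_split; apply: eq_bigr => s _; rewrite mulrDr.
- by move=> V f x f0; apply: sumr_ge0 => s _; rewrite mulr_ge0.
- move=> V x; rewrite -mean_gamma; last exact: bounded_mfun_cst.
  exact: (mean_cst (gamma_law V x)).
- move=> V f k x kV; rewrite mulr_sumr; apply: eq_bigr => s _.
  rewrite (kV (glue x s) x); first by rewrite mulrCA.
  by move=> v /= /negP vV; rewrite glue_out.
- move=> V D f fD x z xz; apply: eq_bigr => s _; congr (fine _ * _).
    apply: g1; last first.
      move=> v vV; apply: xz; split; last by case: vV => /negP.
      by right; exact: boundary_neighbourhood.
    exact: (@coordinate_fields_spins_on (config d) _ (fun x : config d => x)).
  apply: fD => v Dv; have [vV|vV] := boolP (v \in V).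
    by rewrite -[v]/(val [`vV]%fset) !glue_in.
  by rewrite !glue_out//; apply: xz; split; [left|exact/negP].
- move=> V W f x WV.
  (* Consistency is given for measurable events. On the configurations equal to [x] off [V], the
     only ones that matter, [f] agrees with [f1], a finite combination of patterns. *)
  pose f1 : config d -> R := fun z => f (glue x (spins_on V z)).
  have f1E z : (forall v, v \notin V -> z v = x v) -> f z = f1 z.
    by move=> zx; rewrite /f1 spins_onK.
  transitivity (spec_mean V (spec_mean W f1) x).
    apply: eq_spec_mean => s; apply: eq_spec_mean => r; apply: f1E => v vV.
    rewrite !glue_out//; apply: contra vV; exact/fsubsetP.
  transitivity (spec_mean V f1 x); last first.
    by apply: eq_spec_mean => s; rewrite f1E// => v vV; rewrite glue_out.
  have sum_mean U (F : {ffun V -> bool} -> R) (h : {ffun V -> bool} -> config d -> R) y :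
      spec_mean U (fun z => \sum_s F s * h s z) y = \sum_s F s * spec_mean U (h s) y.
    rewrite /spec_mean; under [RHS]eq_bigr do rewrite mulr_sumr.
    rewrite exchange_big; apply: eq_bigr => r _; rewrite mulr_sumr.
    by apply: eq_bigr => s _; rewrite mulrCA.
  have -> : f1 = fun z => \sum_(s : {ffun V -> bool}) f (glue x s) * pattern s z.
    by apply/funext => z; rewrite (@sum_pattern _ _ V (fun s => f (glue x s))).
  rewrite (_ : spec_mean W _ = fun y => \sum_(s : {ffun V -> bool}) f (glue x s) *
      spec_mean W (pattern s) y); last by apply/funext => y; rewrite sum_mean.
  rewrite !sum_mean; apply: eq_bigr => s _; congr (_ * _).
  by rewrite pattern_indic spec_meanK//; exact: measurable_spins_on.
Qed.

Lemma config_leP (x z : config d) : config_le x z <-> spin_le x z.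
Proof. by split=> xz v; move: (xz v); rewrite /spin_val; case: (x v); case: (z v). Qed.

Lemma dominated_gamma : monotone_specification gamma -> dominated spec_mean spec_mean.
Proof.
move=> gmono V f x x' finc xx'.
have glue_le (y y' : config d) (s s' : {ffun V -> bool}) : spin_le y y' ->
    (forall v, s v ==> s' v) -> spin_le (glue y s) (glue y' s').
  move=> yy' ss' v; have [vV|vV] := boolP (v \in V).
    by rewrite -[v]/(val [`vV]%fset) !glue_in.
  by rewrite !glue_out.
(* Monotonicity is given for bounded measurable functions, so [f] is frozen to the lower
   configuration [x] off [V]. The two agree in the mean at [x], and at [x'] unfreezing only
   increases the mean. *)
pose f1 : config d -> R := fun z => f (glue x (spins_on V z)).
have f1V : depends_on [set` V] f1.
  move=> y z yz; rewrite /f1; congr (f (glue x _)); apply/ffunP => v.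
  by rewrite !ffunE yz//=; exact: valP.
have bf1 : bounded_mfun f1 by exact: bounded_mfun_cylinder f1V.
have f1inc : spin_increasing f1.
  move=> y z /config_leP zy; apply: finc; apply: glue_le.
    exact: spin_le_refl.
  by move=> v; rewrite !ffunE; exact: zy.
have E y : spec_mean V f1 y = \sum_(s : {ffun V -> bool})
    fine (gamma V y [set z | spins_on V z = s]) * f (glue x s).
  by apply: eq_bigr => s _; rewrite /f1 spins_on_glue.
have [mf1 bdf1] := bf1.
have := gmono f1 mf1 bdf1 f1inc V x' x; rewrite !mean_gamma// !E.
move=> /(_ _)/le_trans; apply; first exact/config_leP.
apply: ler_sum => s _; rewrite ler_wpM2l ?fine_ge0//; apply/finc/glue_le => //.
by move=> v; case: (s v).
Qed.

Lemma cond_specificationE p y V x A : measurable A ->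
  cond_specification gamma p y V x A =
  (tilt (likelihood (obs_density p) y) spec_mean V \1_A x)%:E.
Proof.
move=> mA; rewrite /cond_specification /tilt.
have bw : bounded_mfun (weight (likelihood (obs_density p) y) V : config d -> R).
  apply: (bounded_mfun_cylinder (U := V)); exact: depends_on_weight.
congr EFin; congr (_ / _); last by rewrite -mean_gamma.
rewrite -mean_gamma; last by apply: bounded_mfunM => //; exact: bounded_mfun_indic.
by apply: eq_Rintegral => z _; rewrite mulrC.
Qed.

Lemma channel_obs_density (p : site d -> R) : (forall v, 0 < p v <= 1 / 2) ->
  channel (obs_density p).
Proof.
move=> hp; split.
- by move=> v s t; rewrite /obs_density; have /andP[? ?] := hp v; case: ifP => _; lra.
- by move=> v s; rewrite /obs_density; case: s => /=; lra.
- by move=> v; rewrite /obs_density /=; have /andP[? ?] := hp v; lra.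
Qed.

End specifications.

(** * Conditioning on the observations *)

Section observations.
Context {R : realType} {d : nat}.
Variable p : site d -> R.
Context {dO : measure_display} {Omega : measurableType dO}.
Variables (P : probability Omega R) (X xi : {mfun Omega >-> config d}).
Hypotheses (hp : forall v, 0 < p v <= 1 / 2)
  (xi_law : forall v, P [set w | spin_val (xi w v) = -1] = (p v)%:E)
  (xi_indep : independent_sites P xi) (X_xi_indep : independent_fields P X xi).

Local Notation g := (obs_density p).
Local Notation Y := (observed X xi).

Let gch : channel g. Proof. exact: channel_obs_density. Qed.

Lemma measurable_observed_spin v : measurable [set w | Y w v].
Proof.
rewrite (_ : [set w | _] = ([set w | X w v] `&` [set w | xi w v]) `|`
    (~` [set w | X w v] `&` ~` [set w | xi w v])).
  by apply: measurableU; apply: measurableI; try apply: measurableC;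
    exact: measurable_coordinate.
rewrite /observed /spin_mul; apply/seteqP; split=> w /=.
  by move=> /eqP ->; case: (xi w v); [left|right].
by move=> [[-> ->]//|[/negP/negbTE -> /negP/negbTE ->]].
Qed.

Lemma measurable_observed : measurable_fun [set: Omega] Y.
Proof. by apply: measurable_to_config => v; exact: measurable_observed_spin. Qed.

Lemma bounded_mfun_observed (f : config d -> R) : bounded_mfun f ->
  bounded_mfun (fun w => f (Y w)).
Proof.
move=> [mf [M fM]]; split; last by exists M.
exact: (measurableT_comp mf measurable_observed).
Qed.

(** Spins multiply as booleans under [==], so [b == c] is the noise value that turns the spin [b]
    into the observation [c]. *)
Lemma noise_law v b c : P [set w | xi w v = (b == c)] = (g v b c)%:E.
Proof.
have pF : P [set w | xi w v = false] = (p v)%:E.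
  rewrite -xi_law; congr (P _); apply/seteqP; split=> w /=; first by move=> ->.
  by case: (xi w v).
rewrite /obs_density; case: eqP => // _.
rewrite (_ : [set w | _] = ~` [set w | xi w v = false]); last first.
  by apply/seteqP; split=> w /=; case: (xi w v).
rewrite probability_setC ?pF//.
rewrite (_ : [set w | _] = ~` [set w | xi w v]); last first.
  by apply/seteqP; split=> w /=; case: (xi w v).
by apply: measurableC; exact: measurable_coordinate.
Qed.

(** Once X is known on [U], observing [t] means that the noise takes a prescribed value at each site
    of [U]; independence from X and between sites yields the product. *)
Lemma joint_pattern_law (U : {fset site d}) (r t : {ffun U -> bool}) x0 y0 :
  \int[P]_w (pattern r (X w) * pattern t (Y w)) =
  \int[P]_w (pattern r (X w) : R) * weight (likelihood g (glue y0 t)) U (glue x0 r).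
Proof.
pose B v := [set b : bool | b = (glue x0 r v == glue y0 t v)].
pose Bc := [set z : config d | forall v, v \in U -> B v (z v)].
have mB : measurable Bc.
  rewrite (_ : Bc = [set z : config d | spins_on U z =
      [ffun v => glue x0 r (val v) == glue y0 t (val v)]]); first exact: measurable_spins_on.
  apply/seteqP; split=> z /=.
    by move=> h; apply/ffunP => v; rewrite !ffunE; exact/h/valP.
  move=> /ffunP h v vU; have := h [`vU]%fset; rewrite !ffunE/=.
  by move=> ->.
have mX : measurable (X @^-1` [set x | spins_on U x = r]).
  rewrite -[X in measurable X]setTI; apply: measurable_funP => //.
  exact: measurable_spins_on.
have mxi : measurable (xi @^-1` Bc).
  by rewrite -[X in measurable X]setTI; apply: measurable_funP.
transitivity (\int[P]_w \1_(X @^-1` [set x | spins_on U x = r] `&` xi @^-1` Bc) w).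
  apply: eq_Rintegral => w _; rewrite !pattern_indic indicI /= !indic_preimage.
  rewrite !indicE; case: (boolP (X w \in _)) => [|_]; last by rewrite !mul0r.
  rewrite inE/= => Xr; rewrite !mul1r; congr (nat_of_bool _)%:R.
  apply/idP/idP; rewrite !inE /Bc /B/=.
    move=> /ffunP Yt v vU; pose v' : U := [`vU]%fset.
    rewrite -[v]/(val v') !glue_in -Xr -Yt !ffunE /observed /spin_mul.
    by case: (X w _); case: (xi w _).
  move=> h; apply/ffunP => v; have := h _ (valP v).
  rewrite -Xr !glue_in !ffunE /observed /spin_mul => ->.
  by case: (X w _); case: (t v).
apply: EFin_inj; rewrite mean_indic; last exact: measurableI.
rewrite X_xi_indep//; last exact: measurable_spins_on.
rewrite EFinM; congr (_ * _)%E.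
  rewrite -mean_indic//; congr EFin; apply: eq_Rintegral => w _.
  by rewrite pattern_indic indic_preimage.
rewrite -[LHS]/(P [set w | forall v, v \in U -> B v (xi w v)]) xi_indep /weight.
rewrite -prodEFin; apply: eq_bigr => v _; exact: noise_law.
Qed.

Definition cylinder2 (U : {fset site d}) (F : config d -> config d -> R) :=
  (forall y, depends_on [set` U] (F ^~ y)) /\ (forall x, depends_on [set` U] (F x)).

Lemma cylinder2_sum U F x0 y0 x y : cylinder2 U F ->
  F x y = \sum_(r : {ffun U -> bool}) \sum_(t : {ffun U -> bool})
    F (glue x0 r) (glue y0 t) * (pattern r x * pattern t y).
Proof.
move=> [F1 F2]; rewrite [LHS](congr1 (@^~ x) (cylinder_sum x0 (F1 y))).
apply: eq_bigr => r _; rewrite [in LHS](congr1 (@^~ y) (cylinder_sum y0 (F2 _))) mulr_suml.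
by apply: eq_bigr => t _; rewrite -mulrA [pattern t y * _]mulrC.
Qed.

Lemma bounded_mfun_pattern2 (U : {fset site d}) (r t : {ffun U -> bool}) :
  bounded_mfun (fun w => pattern r (X w) * pattern t (Y w) : R).
Proof.
apply: bounded_mfunM; first exact/bounded_mfun_comp/cylinder_bounded_mfun/cylinder_pattern.
exact/bounded_mfun_observed/cylinder_bounded_mfun/cylinder_pattern.
Qed.

Lemma bounded_mfun_joint U F : cylinder2 U F -> bounded_mfun (fun w => F (X w) (Y w)).
Proof.
move=> FU; under eq_fun do rewrite (cylinder2_sum (@top _) (@top _) _ _ FU).
apply: bounded_mfun_sum => r; apply: bounded_mfun_sum => t.
exact/bounded_mfunZ/bounded_mfun_pattern2.
Qed.

Lemma mean_joint U F y0 : cylinder2 U F -> \int[P]_w F (X w) (Y w) =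
  \int[P]_w \sum_(t : {ffun U -> bool})
    F (X w) (glue y0 t) * weight (likelihood g (glue y0 t)) U (X w).
Proof.
move=> FU; have [F1 F2] := FU; pose x0 : config d := @top _.
under eq_Rintegral do rewrite (cylinder2_sum x0 y0 _ _ FU).
pose H x := \sum_(t : {ffun U -> bool})
  F x (glue y0 t) * weight (likelihood g (glue y0 t)) U x.
have HU : depends_on [set` U] H.
  by apply: depends_on_sum => t; apply: depends_onM => //; exact: depends_on_weight.
transitivity (\int[P]_w H (X w)); last by [].
rewrite (cylinder_sum x0 HU).
have bp (r : {ffun U -> bool}) : bounded_mfun (fun w => pattern r (X w) : R).
  exact/bounded_mfun_comp/cylinder_bounded_mfun/cylinder_pattern.
rewrite !mean_sum; last 2 first.
- by move=> r; apply: bounded_mfunZ.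
- move=> r; apply: bounded_mfun_sum => t.
  exact/bounded_mfunZ/bounded_mfun_pattern2.
apply: eq_bigr => r _; rewrite RintegralZl//; last exact: bounded_mfun_integrable.
rewrite mean_sum; last by move=> t; exact/bounded_mfunZ/bounded_mfun_pattern2.
rewrite /H mulr_suml; apply: eq_bigr => t _.
rewrite RintegralZl//; last exact/bounded_mfun_integrable/bounded_mfun_pattern2.
by rewrite (joint_pattern_law _ _ x0 y0) -mulrA [_ * weight _ _ _]mulrC.
Qed.

(** * Posterior kernels of the hidden field *)

Section conditioning.
Variables (L : {fset site d} -> (config d -> R) -> config d -> R)
  (N : {fset site d} -> {fset site d}).
Hypotheses (LN : spec_op L N) (Lmono : dominated L L) (Xdlr : dlr L P X).

Local Notation Ly y := (tilt (likelihood g y) L).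

Lemma spec_op_posterior y : spec_op (Ly y) N.
Proof. by apply: spec_op_tilt => //; exact: channel_positive. Qed.

Lemma dominated_posterior y y' : spin_le y y' -> dominated (Ly y) (Ly y').
Proof.
move=> yy'; apply: (dominated_tilt LN) => //; try exact: channel_positive.
exact: channel_tilt_le.
Qed.

(** Averaging over Y given X leaves a function of the spins of X on [W], and the DLR equations
    resample those spins by [L W]. *)
Let mean_posterior W f x0 :
  \int[P]_w Ly (Y w) W f x0 =
  \int[P]_w L W (fun z => noise g W (fun y => Ly y W f x0) z (@top _)) (X w).
Proof.
pose Phi y := Ly y W f x0; have PhiW : depends_on [set` W] Phi.
  exact: depends_on_tilt_obs.
rewrite -[RHS]Xdlr; last first.
  exists W => x z xz; rewrite !(noiseE _ _ (@top _) _ PhiW); apply: eq_bigr => t _.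
  by congr (_ * _); exact: depends_on_weight xz.
rewrite (@mean_joint W (fun _ y => Phi y) (@top _)); last by split=> // x.
by apply: eq_Rintegral => w _; rewrite (noiseE _ _ (@top _) _ PhiW).
Qed.

Let posterior_noise (W : {fset site d}) (f : config d -> R) (x0 : config d) : increasing f ->
  let Psi z := noise g W (fun y => Ly y W f x0) z (@top _) in
  increasing Psi /\ bounded_mfun (fun w => L W Psi (X w)).
Proof.
move=> finc Psi; split.
  apply: increasing_noise => // y y' yy'.
  by apply: dominated_posterior => //; exact: spin_le_refl.
apply: bounded_mfun_comp; apply: cylinder_bounded_mfun; apply: (op_cylinder LN).
exists W => x z xz; rewrite /Psi !(noiseE _ _ (@top _) _ (@depends_on_tilt_obs _ _ L g W f x0)).
by apply: eq_bigr => t _; congr (_ * _); exact: depends_on_weight xz.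
Qed.

Lemma mean_posterior_top W f : increasing f ->
  \int[P]_w Ly (Y w) W f (@top _) <= L W f (@top _).
Proof.
move=> finc; rewrite mean_posterior; have [Pinc Pb] := posterior_noise W (@top _) finc.
rewrite -[leRHS](mean_cst P); apply: mean_le => //; first exact: bounded_mfun_cst.
move=> w; rewrite -[leRHS](op_noise_tilt W f (@top _) LN gch).
exact: Lmono (spin_le_top _).
Qed.

Lemma mean_posterior_bottom W f : increasing f ->
  L W f (@bottom _) <= \int[P]_w Ly (Y w) W f (@bottom _).
Proof.
move=> finc; rewrite mean_posterior; have [Pinc Pb] := posterior_noise W (@bottom _) finc.
rewrite -[leLHS](mean_cst P); apply: mean_le => //; first exact: bounded_mfun_cst.
move=> w; rewrite -[leLHS](op_noise_tilt W f (@bottom _) LN gch).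
exact: Lmono (spin_bottom_le _).
Qed.

Lemma bounded_mfun_posterior (W : {fset site d}) (f : config d -> R) (x0 : config d) :
  bounded_mfun (fun w => Ly (Y w) W f x0).
Proof.
apply: (bounded_mfun_observed (f := fun y => Ly y W f x0)).
by apply: (@bounded_mfun_cylinder _ _ W); exact: depends_on_tilt_obs.
Qed.

Lemma bounded_mfun_gap W v : bounded_mfun (fun w => gap (Ly (Y w)) W v).
Proof. by apply: bounded_mfunB; exact: bounded_mfun_posterior. Qed.

Lemma mean_gap_le W v : \int[P]_w gap (Ly (Y w)) W v <= gap L W v.
Proof.
rewrite RintegralB//; try exact/bounded_mfun_integrable/bounded_mfun_posterior.
apply: lerB; first exact: mean_posterior_top (increasing_spin v).
exact: mean_posterior_bottom (increasing_spin v).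
Qed.

(** One null set must serve all sites, hence the countable family [small], indexed by the code of a
    site and a tolerance. By Markov's inequality, the probability that the gap exceeds 1/(k+1) in
    every box is at most k+1 times the gap of [L] in any given box, so it is 0. Since gaps decrease,
    being small in one box implies being small in all later ones. *)
Lemma posterior_gap_vanishes : (forall v, gap L (box n) v @[n --> \oo] --> 0) ->
  {ae P, forall w, forall v, gap (Ly (Y w)) (box n) v @[n --> \oo] --> 0}.
Proof.
move=> gap0.
pose small m k w := if pickle_inv m is Some v then
  exists n, gap (Ly (Y w)) (box n) v <= k.+1%:R^-1 else True.
have small_ae m k : {ae P, forall w, small m k w}.
  rewrite /small; case: pickle_inv => [v|]; last exact: aeW.
  pose C := \bigcap_n [set w | k.+1%:R^-1 < gap (Ly (Y w)) (box n) v].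
  have mC : measurable C.
    apply: bigcapT_measurable => n; have [mg _] := bounded_mfun_gap (box n) v.
    rewrite (_ : [set w | _] = (fun w => gap (Ly (Y w)) (box n) v) @^-1` `]k.+1%:R^-1, +oo[).
      by rewrite -[X in measurable X]setTI; exact: (mg measurableT).
    by apply/seteqP; split=> w /=; rewrite in_itv/= andbT.
  exists C; split=> //; last first.
    move=> w /= h n _ /=; rewrite ltNge; apply/negP => gk; apply: h; by exists n.
  rewrite -mean_indic//; congr EFin; apply/eqP; rewrite eq_le Rintegral_ge0// andbT.
  have k0 : 0 < k.+1%:R^-1 :> R by rewrite invr_gt0.
  have bound n : k.+1%:R^-1 * \int[P]_w (\1_C w : R) <= gap L (box n) v.
    apply: le_trans (mean_gap_le _ _); rewrite -RintegralZl//; last first.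
      exact/bounded_mfun_integrable/bounded_mfun_indic.
    apply: mean_le; [exact/bounded_mfunZ/bounded_mfun_indic|exact: bounded_mfun_gap|].
    move=> w; rewrite indicE; case: (boolP (w \in C)) => [|_].
      by rewrite inE => /(_ n Logic.I)/= /ltW; rewrite mulr1.
    rewrite mulr0; apply: (gap_ge0 (L := Ly (Y w))).
    exact: dominated_posterior (spin_le_refl _).
  rewrite -(pmulr_rle0 _ k0).
  rewrite -[leRHS](cvg_lim (@Rhausdorff R) (gap0 v)); apply: limr_ge; last exact: nearW.
  by apply/cvg_ex; exists 0; exact: gap0.
have : {ae P, forall w, forall m k, small m k w}.
  by apply: ae_foralln => m; apply: ae_foralln => k; exact: small_ae.
apply: filterS => w sw v; apply/cvgrPdist_le => e e0.
have [k ke] : exists k : nat, k.+1%:R^-1 <= e.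
  by have /ltr_add_invr[k] : 0 < e by []; rewrite add0r => /ltW ?; exists k.
have := sw (choice.pickle v) k; rewrite /small pickleK_inv => -[n0 hn0].
exists n0 => // n /= n0n; have LyN := spec_op_posterior (Y w).
have Lym : dominated (Ly (Y w)) (Ly (Y w)) by exact: dominated_posterior (spin_le_refl _).
rewrite sub0r normrN ger0_norm ?(gap_ge0 Lym)//.
apply: le_trans ke; apply: le_trans hn0.
by apply: (gap_antitone LyN Lym); exact: box_mono.
Qed.

(** The factor [r] stands for the likelihoods of observations off [W]. Both [c] and [r] come out of
    [L W], and so does the posterior mean, whose normaliser cancels against the mean of the
    remaining weight. *)
Let op_posterior (W : {fset site d}) (c f r : config d -> R) (y x : config d) :
  depends_on (~` [set` W]) c -> depends_on (~` [set` W]) r ->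
  L W (fun z => c z * Ly y W f z * (weight (likelihood g y) W z * r z)) x =
  L W (fun z => c z * f z * (weight (likelihood g y) W z * r z)) x.
Proof.
move=> cW rW; set G := weight (likelihood g y) W.
have G0 : L W G x != 0.
  by rewrite gt_eqF// (op_weight_gt0 _ _ LN)//; exact: channel_positive.
transitivity (L W (fun z => (c z * r z * Ly y W f z) * G z) x).
  by congr L; apply/funext => z; ring.
rewrite (opM LN); last first.
  apply: depends_onM; first exact: depends_onM.
  exact: (op_off (spec_op_posterior y)).
transitivity (L W (fun z => (c z * r z) * (G z * f z)) x); last first.
  by congr L; apply/funext => z; ring.
by rewrite (opM LN); [rewrite -mulrA /tilt divfK|exact: depends_onM].
Qed.

(** The conditional mean of [f] given X off [W] and Y, tested on products. [U] is taken to hold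
    every site read by any factor, including the neighbourhood of [W]: Y can then be summed out on
    [U], and the DLR equations on [W] reduce the claim to a single boundary condition and
    observation. *)
Lemma mean_posterior_cond W (k1 k2 f : config d -> R) :
  cylinder k1 -> depends_on (~` [set` W]) k1 -> cylinder k2 -> cylinder f ->
  \int[P]_w (k1 (X w) * k2 (Y w) * Ly (Y w) W f (X w)) =
  \int[P]_w (k1 (X w) * k2 (Y w) * f (X w)).
Proof.
move=> [U1 k1U] k1W [U2 k2U] [V fV].
pose U := (U1 `|` U2 `|` (W `|` (V `|` N W)))%fset.
have sub (D : {fset site d}) k : (D `<=` U)%fset -> depends_on [set` D] k ->
    depends_on [set` U] (k : config d -> R).
  by move=> DU; apply: depends_onW => v /=; exact: (fsubsetP DU).
have [U1U U2U WU VU NU] : [/\ (U1 `<=` U)%fset, (U2 `<=` U)%fset, (W `<=` U)%fset,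
    (V `<=` U)%fset & (N W `<=` U)%fset].
  by split; apply/fsubsetP => v vD; rewrite !in_fsetU vD ?orbT.
have LyU y : depends_on [set` U] (Ly y W f).
  apply: depends_onW (op_depends (spec_op_posterior y) fV) => v [[|] + _] /=;
    exact: (fsubsetP _ _).
have FU : cylinder2 U (fun x y => k1 x * k2 y * Ly y W f x).
  split=> [y|x] /=.
    by apply: depends_onM => //; apply: depends_onM => //; exact: sub k1U.
  apply: depends_onM; first by apply: depends_onM => //; exact: sub k2U.
  by apply: sub (@depends_on_tilt_obs _ _ L g W f x).
have FU' : cylinder2 U (fun x y => k1 x * k2 y * f x).
  split=> [y|x] /=.
    by apply: depends_onM; [apply: depends_onM => //; exact: sub k1U|exact: sub fV].
  by apply: depends_onM => //; apply: depends_onM => //; exact: sub k2U.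
rewrite (mean_joint (@top _) FU) (mean_joint (@top _) FU').
have [FUx _] := FU; have [FUx' _] := FU'.
have cyl F y : depends_on [set` U] (F : config d -> R) ->
    cylinder (fun x => F x * weight (likelihood g y) U x).
  by move=> FD; exists U; apply: depends_onM => //; exact: depends_on_weight.
rewrite !mean_sum; last 2 first.
- by move=> t; exact: (bounded_mfun_comp X (cylinder_bounded_mfun (cyl _ _ (FUx' _)))).
- by move=> t; exact: (bounded_mfun_comp X (cylinder_bounded_mfun (cyl _ _ (FUx _)))).
apply: eq_bigr => t _; set y := glue _ t.
rewrite (Xdlr W (cyl _ y (FUx y))) (Xdlr W (cyl _ y (FUx' y))).
apply: eq_Rintegral => w _.
under eq_fun do rewrite (weightD _ _ WU).
under [in RHS]eq_fun do rewrite (weightD _ _ WU).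
apply: op_posterior; first exact: depends_onM.
apply: (depends_onW _ (@depends_on_weight _ _ _ _)) => v /=; rewrite !inE => /andP[vW _].
exact/negP.
Qed.

(** * Conditional probabilities given Y, with and without X off W *)

Lemma coordinate_fields_preimage (T : pointedType) (Z : T -> config d) (A : set (config d)) :
  measurable A -> <<s coordinate_fields Z [set: site d] >> (Z @^-1` A).
Proof.
move=> mA; pose TZ := g_sigma_algebraType (coordinate_fields Z [set: site d]).
have mZ : measurable_fun [set: TZ] (Z : TZ -> config d).
  by apply: measurable_to_config => v; exact: (@coordinate_fields_spin _ _ Z).
by have := mZ measurableT A mA; rewrite setTI.
Qed.

(* The pairs (X, Y) form a field indexed by two copies of the lattice. *)
Let joint_field (w : Omega) (i : site d + site d) : bool :=
  match i with inl v => X w v | inr v => Y w v end.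

Let joint_domain (W : {fset site d}) : set (site d + site d) :=
  [set i | match i with inl v => v \notin W | inr _ => True end].

Let joint_sigma W :=
  <<s sigma_field X (complement W) `|` sigma_field Y setT >>.

Let joint_sigma_sub W :
  joint_sigma W `<=` <<s coordinate_fields joint_field (joint_domain W) >>.
Proof.
apply: smallest_sub; first exact: smallest_sigma_algebra.
move=> A [|]; apply: smallest_sub => //; try exact: smallest_sigma_algebra.
- move=> _ [v vW [B mB <-]]; apply: sub_sigma_algebra; exists (inl v) => //.
  by exists B.
- move=> _ [v vW [B mB <-]]; apply: sub_sigma_algebra; exists (inr v) => //.
  by exists B.
Qed.

Let measurable_joint_field i : measurable [set w | joint_field w i].
Proof.
case: i => v; [exact: measurable_coordinate|exact: measurable_observed_spin].
Qed.

Let joint_sigma_measurable W : joint_sigma W `<=` measurable.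
Proof.
move=> A /joint_sigma_sub; apply: measurable_coordinate_fields.
exact: measurable_joint_field.
Qed.

Let bounded_mfun_posterior_field W (f : config d -> R) : cylinder f ->
  bounded_mfun (fun w => Ly (Y w) W f (X w)).
Proof.
move=> [V fV].
apply: (@bounded_mfun_joint (W `|` (V `|` N W))%fset (fun x y => Ly y W f x)).
split=> [y|x] /=.
  apply: depends_onW (op_depends (spec_op_posterior y) fV) => v [[|] /= + _];
    by rewrite !in_fsetU => ->; rewrite ?orbT.
apply: depends_onW (@depends_on_tilt_obs _ _ L g W f x) => v /= vW.
by rewrite in_fsetU vW.
Qed.

Let integral_posterior W (f : config d -> R) : cylinder f -> forall C, joint_sigma W C ->
  (\int[P]_(w in C) (Ly (Y w) W f (X w))%:E = \int[P]_(w in C) (f (X w))%:E)%E.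
Proof.
move=> fC C /joint_sigma_sub.
have bf : bounded_mfun (fun w => f (X w)) by exact/bounded_mfun_comp/cylinder_bounded_mfun.
have bL := bounded_mfun_posterior_field W fC.
apply: integral_coordinate_unique.
- exact: measurable_joint_field.
- exact: bounded_mfun_integrable.
- exact: bounded_mfun_integrable.
move=> U UD; have mU := @measurable_up_cylinder _ _ _ joint_field measurable_joint_field U.
rewrite !integral_EFin_indic//; try exact: bounded_mfun_integrable.
pose U1 : {fset site d} := [fset v in pmap (fun i => if i is inl v then Some v else None) U]%fset.
pose U2 : {fset site d} := [fset v in pmap (fun i => if i is inr v then Some v else None) U]%fset.
have inU1 v : (v \in U1) = (inl v \in U).
  rewrite !inE mem_pmap; apply/mapP/idP => [[[u|u] uU]|vU] //; first by case=> ->.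
  by exists (inl v).
have inU2 v : (v \in U2) = (inr v \in U).
  rewrite !inE mem_pmap; apply/mapP/idP => [[[u|u] uU]|vU] //; first by case=> ->.
  by exists (inr v).
pose c (D : {fset site d}) : config d -> R := \1_(up_cylinder (fun x : config d => x) D).
have cD D : depends_on [set` D] (c D) by exact: depends_on_up_cylinder.
have cE w : \1_(up_cylinder joint_field U) w = c U1 (X w) * c U2 (Y w) :> R.
  rewrite /c !indicE -natrM mulnb; congr (nat_of_bool _)%:R.
  apply/idP/andP; rewrite !inE.
    by move=> h; split=> v; rewrite ?inU1 ?inU2 => /h.
  by move=> [h1 h2] [v|v] vU; [apply: h1; rewrite inU1|apply: h2; rewrite inU2].
congr EFin; under eq_Rintegral do rewrite cE; under [RHS]eq_Rintegral do rewrite cE.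
apply: mean_posterior_cond => //; [by exists U1| |by exists U2].
apply: (depends_onW _ (cD U1)) => v /=; rewrite inU1 => /UD /=.
by move=> /negP.
Qed.

Lemma posterior_conditionally_mixing :
  (forall v, gap L (box n) v @[n --> \oo] --> 0) -> conditionally_mixing P X Y.
Proof.
move=> gap0 V A E.
pose f : config d -> R := \1_[set x | A (restriction V x)].
have fV : depends_on [set` V] f.
  move=> x z xz; rewrite /f !indicE; congr (nat_of_bool _)%:R.
  suff -> : (x \in [set x | A (restriction V x)]) = (z \in [set x | A (restriction V x)]) by [].
  have xzV : restriction V x = restriction V z.
    by apply/ffunP => v; rewrite !ffunE xz//=; exact: valP.
  by apply/idP/idP; rewrite !inE /= xzV.
have fE w : f (X w) = \1_E w by rewrite /f -indic_preimage.
have mE : measurable E.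
  have [mf _] := bounded_mfun_comp X (bounded_mfun_cylinder fV).
  rewrite (_ : E = (fun w => f (X w)) @^-1` [set 1]).
    by rewrite -[X in measurable X]setTI; exact: (mf measurableT).
  apply/seteqP; split=> w /=; rewrite fE indicE.
    by move=> Ew; rewrite mem_set.
  by case: (boolP (w \in E)) => [|_ /eqP]; [rewrite inE|rewrite eq_sym oner_eq0].
have f1 x z : f x - f z <= 1.
  by rewrite /f !indicE; case: (_ \in _); case: (_ \in _); rewrite /=; lra.
pose G2 := sigma_field Y setT.
have sG2 : sigma_algebra setT G2 by exact: smallest_sigma_algebra.
have G2m : G2 `<=` measurable.
  exact/measurable_coordinate_fields/measurable_observed_spin.
have [c2m c2i c2E] := is_cond_prob_cond_prob P sG2 G2m mE.
(* Both conditional probabilities are compared with the same [Z], at the cost of one sum of gaps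
   each: hence the 2. *)
have bound W : (\int[P]_w `|cond_prob P (joint_sigma W) E w - cond_prob P G2 E w| <=
    2 * \sum_(v <- V) gap L W v).
  have sG1 : sigma_algebra setT (joint_sigma W) by exact: smallest_sigma_algebra.
  have [c1m c1i c1E] := is_cond_prob_cond_prob P sG1 (@joint_sigma_measurable W) mE.
  pose K w := Ly (Y w) W f (X w); pose Z w := Ly (Y w) W f (@top _).
  have bZ : bounded_mfun Z by exact: bounded_mfun_posterior.
  have fC : cylinder f by exists V.
  have bK : bounded_mfun K by exact: bounded_mfun_posterior_field.
  have GZ D : measurable D -> G2 (Z @^-1` D).
    move=> mD; pose phi (y : config d) := Ly y W f (@top _).
    have [mphi _] : bounded_mfun phi.
      by apply: (@bounded_mfun_cylinder _ _ W); exact: depends_on_tilt_obs.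
    apply: (@coordinate_fields_preimage Omega Y (phi @^-1` D)).
    by rewrite -[X in measurable X]setTI; exact: (mphi measurableT).
  have G21 : G2 `<=` joint_sigma W by move=> B ?; apply: sub_sigma_algebra; right.
  have KE C : joint_sigma W C -> (\int[P]_(w in C) (K w)%:E = P (E `&` C))%E.
    move=> GC; rewrite integral_posterior//; have mC := joint_sigma_measurable GC.
    under eq_integral do rewrite fE.
    by rewrite integral_indic.
  have KZ : \int[P]_w `|K w - Z w| <= \sum_(v <- V) gap L W v.
    apply: (@le_trans _ _ (\int[P]_w \sum_(v <- V) gap (Ly (Y w)) W v)).
      apply: le_Rintegral => //.
      - by apply: integrable_dist; exact: bounded_mfun_integrable.
      - by apply/bounded_mfun_integrable/bounded_mfun_sum => v; exact: bounded_mfun_gap.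
      move=> w _; apply: (op_top_dist (spec_op_posterior (Y w))) => //.
      exact: dominated_posterior (spin_le_refl _).
    rewrite mean_sum; last by move=> v; exact: bounded_mfun_gap.
    by apply: ler_sum => v _; exact: mean_gap_le.
  have i1 := bounded_mfun_integrable P bK; have i2 := bounded_mfun_integrable P bZ.
  have d1 : \int[P]_w `|cond_prob P (joint_sigma W) E w - Z w| <= \int[P]_w `|K w - Z w|.
    apply: (mean_normB_le sG1 (@joint_sigma_measurable W)) => //.
      by move=> D mD; apply: G21; exact: GZ.
    by move=> C GC; rewrite c1E// KE.
  (* The contraction again, now for the smaller sigma-algebra: [Z] is measurable for it, and over
     its events too [K] has the integrals of the indicator of [E]. *)
  have d2 : \int[P]_w `|cond_prob P G2 E w - Z w| <= \int[P]_w `|K w - Z w|.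
    apply: (mean_normB_le sG2 G2m) => //.
    by move=> C GC; rewrite c2E// KE//; exact: G21.
  apply: (@le_trans _ _ (\int[P]_w (`|cond_prob P (joint_sigma W) E w - Z w| +
      `|cond_prob P G2 E w - Z w|))).
    apply: le_Rintegral => //; first exact: integrable_dist.
      have := integrable_lin 1 1 (integrable_dist c1i i2) (integrable_dist c2i i2).
      by apply: eq_integrable => // w _ /=; rewrite !mul1r.
    move=> w _; rewrite [X in _ <= _ + X]distrC.
    by apply: le_trans (ler_normD _ _); rewrite addrA subrK.
  rewrite RintegralD//; try exact: integrable_dist.
  by rewrite mulr_natl mulr2n; apply: lerD; exact: le_trans KZ.
pose I W := \int[P]_w `|cond_prob P (joint_sigma W) E w - cond_prob P G2 E w|.
have I0 : I W @[W --> fset_net (site d)] --> 0.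
  apply/cvgrPdist_le => e e0.
  have : (\sum_(v <- V) gap L (box n) v) @[n --> \oo] --> \sum_(v <- V) (0 : R).
    by apply: cvg_big => [|v _]; [exact: add_continuous|exact: gap0].
  rewrite big1// => /cvgrPdist_le/(_ (e / 2)) [|n _ /(_ n (leqnn n))].
    by rewrite divr_gt0.
  (* One box with small gaps settles the limit along the net, because gaps decrease under
     inclusion. *)
  rewrite sub0r normrN => gn; exists (box n) => // W /= nW.
  rewrite sub0r normrN ger0_norm; last by apply: Rintegral_ge0 => w _.
  apply: le_trans (bound W) _.
  rewrite mulrC -ler_pdivlMr//; apply: le_trans (le_trans (ler_norm _) gn).
  by apply: ler_sum => v _; exact: (gap_antitone LN Lmono).
rewrite (_ : (fun W => _) = EFin \o I).
  by apply: cvg_EFin; [exact: nearW|exact: I0].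
apply/funext => W /=; rewrite unlock /I EFin_mean//.
have sG1 : sigma_algebra setT (joint_sigma W) by exact: smallest_sigma_algebra.
have [_ c1i _] := is_cond_prob_cond_prob P sG1 (@joint_sigma_measurable W) mE.
exact: integrable_dist.
Qed.

End conditioning.
End observations.

Theorem theorem5p12 (R : realType) (d : nat)
  (gamma : {fset site d} -> R.-pker (config d) ~> (config d))
  (p : site d -> R)
  (dO : measure_display) (Omega : measurableType dO) (P : probability Omega R)
  (X xi : {mfun Omega >-> config d}) :
  is_specification gamma ->
  specified_by P X (fun V x => gamma V x) ->
  (forall v, 0 < p v <= 1 / 2) ->
  (forall v, P [set w | spin_val (xi w v) = -1] = (p v)%:E) ->
  independent_sites P xi ->
  independent_fields P X xi ->
  monotone_specification gamma ->
  gibbs_unique (fun V x => gamma V x) ->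
  {ae P, forall w, gibbs_unique (cond_specification gamma p (observed X xi w))}
  /\ conditionally_mixing P X (observed X xi).
Proof.
move=> gspec Xgamma hp xi_law xi_indep X_xi gmono guniq.
have LN := spec_op_gamma gspec; have Lmono := dominated_gamma gspec gmono.
have gE := gammaE gspec; have Xdlr := specified_dlr LN gE Xgamma.
have gap0 := gibbs_unique_gap_vanishes LN Lmono gE guniq.
split; last exact: (posterior_conditionally_mixing hp xi_law xi_indep X_xi LN Lmono Xdlr gap0).
have := posterior_gap_vanishes hp xi_law xi_indep X_xi LN Lmono Xdlr gap0.
(* From here [w] is fixed, and the uniqueness criterion is applied to the operator tilted by the
   observation at [w]. *)
apply: filterS => w gapw; have gch := channel_obs_density hp.
apply: (gap_vanishes_gibbs_unique (spec_op_posterior hp LN _)) gapw.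
  exact: (dominated_posterior hp LN Lmono (spin_le_refl _)).
by move=> V x A mA; exact: cond_specificationE.
Qed.
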